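(* There exists a non-metrisable surface with a minimal foliation (of dimension $1$) containing exactly one long leaf, this long leaf being not embedded, and all other leaves being real lines (homeomorphic to $\mathbb R$).
   Context: Manifolds are connected Hausdorff, locally Euclidean spaces (not assumed metrisable or second countable), without boundary. A surface is a $2$-dimensional manifold. A foliation (always of dimension $1$, topological) on an $n$-manifold $M$ is given by a maximal atlas of foliated charts $\varphi:U\to\mathbb R\times\mathbb R^{n-1}$ (homeomorphisms from open sets $U$ covering $M$ onto open boxes) whose coordinate changes are locally of the form $(x,y)\mapsto(f(x,y),g(y))$ with $y\in\mathbb R^{n-1}$. Plaques are the sets $\varphi^{-1}(\mathbb R\times\{y\})$; the leaf topology on $M$ is the topology generated by the open subsets of plaques, and leaves are the connected components of $M$ in the leaf topology, each a connected $1$-manifold. The homeomorphism type of a leaf refers to its leaf topology. A leaf is embedded if its leaf topology coincides with the subspace topology inherited from $M$. A foliation is minimal if every leaf is dense in the manifold. The closed long ray $\mathbb L_{\ge0}$ is $\omega_1\times[0,1)$ with the lexicographic order topology; the long ray is $\mathbb L_+=\mathbb L_{\ge0}\setminus\{0\}$; the long line $\mathbb L$ is obtained by gluing two copies of $\mathbb L_{\ge 0}$ along their endpoint $0$. A leaf is long if it is homeomorphic to $\mathbb L_+$ or $\mathbb L$. *)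

(* Defs.v *)
From HB Require Import structures.
From mathcomp Require Import all_boot all_order all_algebra.
From mathcomp Require Import all_classical wochoice all_reals all_analysis wedge_sigT.

Set Implicit Arguments.
Unset Strict Implicit.
Unset Printing Implicit Defensive.

Import Order.TTheory GRing.Theory Num.Theory.
Import numFieldNormedType.Exports.

Local Open Scope classical_set_scope.
Local Open Scope ring_scope.

Definition homeomorphic (X Y : topologicalType) : Prop :=
  exists (f : X -> Y) (g : Y -> X),
    [/\ cancel f g, cancel g f, continuous f & continuous g].

Definition metrizable (R : realType) (X : topologicalType) : Prop :=
  exists Y : metricType R, homeomorphic X Y.

(* omega1 is realized as the set of elements having countably many
   predecessors, for a chosen well-ordering of the uncountable type [set nat].
   The lemmas [omega1_wf], [omega1_uncountable] and [omega1_countable_initial]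
   characterize it up to order isomorphism. *)
Definition wo_le : rel (set nat) := sval (well_ordering_principle (set nat)).

Lemma wo_leP : well_order wo_le.
Proof. exact: (svalP (well_ordering_principle (set nat))). Qed.

Lemma wo_le_chain : wo_chain wo_le predT.
Proof. by move=> A _; apply: wo_leP. Qed.

Lemma wo_le_anti : antisymmetric wo_le.
Proof.
by move=> x y; apply: (wo_chain_antisymmetric wo_le_chain).
Qed.

Lemma wo_le_total : total wo_le.
Proof. by move=> x y; apply: (wo_chainW wo_le_chain). Qed.

Lemma wo_le_min (A : set (set nat)) :
  A !=set0 -> exists2 x, A x & forall y, A y -> wo_le x y.
Proof.
move=> [a Aa].
have [|x [[/asboolP Ax minx] _]] :=
  wo_leP (A := [pred x | `[< A x >]]); first by exists a; apply/asboolP.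
by exists x => // y Ay; apply: minx; apply/asboolP.
Qed.

Lemma wo_le_trans : transitive wo_le.
Proof.
move=> y x z xy yz.
have [|m [->|[->|->]] mP] := @wo_le_min [set t | t = x \/ t = y \/ t = z].
- by exists x; left.
- by apply: mP; right; right.
- have yx : wo_le y x by apply: mP; left.
  by rewrite (wo_le_anti (introT andP (conj xy yx))).
- have zy : wo_le z y by apply: mP; right; left.
  by rewrite -(wo_le_anti (introT andP (conj yz zy))).
Qed.

Definition omega1 : Type :=
  {X : set nat | countable [set Y | wo_le Y X]}.

HB.instance Definition _ := [isSub of omega1 for @sval _ _].
HB.instance Definition _ := [Choice of omega1 by <:].

Definition omega1_le : rel omega1 := fun x y => wo_le (val x) (val y).

Fact omega1_display : Order.disp_t. Proof. exact. Qed.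

Lemma omega1_le_refl : reflexive omega1_le.
Proof. by move=> x; have := wo_le_total (val x) (val x); rewrite orbb. Qed.

Lemma omega1_le_anti : antisymmetric omega1_le.
Proof. by move=> x y /wo_le_anti/val_inj. Qed.

Lemma omega1_le_trans : transitive omega1_le.
Proof. by move=> y x z; apply: wo_le_trans. Qed.

HB.instance Definition _ := Order.Le_isPOrder.Build omega1_display omega1
  omega1_le_refl omega1_le_anti omega1_le_trans.

Lemma omega1_le_total : total (<=%O : rel omega1).
Proof. by move=> x y; apply: wo_le_total. Qed.

HB.instance Definition _ :=
  Order.POrder_isTotal.Build omega1_display omega1 omega1_le_total.

Lemma omega1_wf (A : set omega1) :
  A !=set0 -> exists2 x, A x & forall y, A y -> (x <= y)%O.
Proof.
move=> [a Aa]; have [|_ [x Ax <-] xmin] := @wo_le_min (val @` A).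
  by exists (val a), a.
by exists x => // y Ay; apply: xmin; exists y.
Qed.

Lemma omega1_countable_initial (x : omega1) :
  countable [set y : omega1 | (y <= x)%O].
Proof.
have /countable_injP[f finj] := valP x.
apply/countable_injP; exists (f \o val) => y z yx zx /= fyz.
move: yx zx; rewrite !inE => yx zx.
by apply/val_inj/finj; rewrite ?inE.
Qed.

Lemma set_nat_uncountable : ~ countable [set: set nat].
Proof.
move=> /countable_injP[f finj].
have {}finj : injective f by move=> X Y; apply: finj; rewrite inE.
pose D : set nat := [set n | exists2 X, f X = n & ~ X n].
have nD : ~ D (f D) by move=> /[dup] DfD [X /finj ->].
by apply: (nD); exists D.
Qed.

Lemma omega1_uncountable : ~ countable [set: omega1].
Proof.
move=> /countable_injP[f finj].
have {}finj : injective f by move=> x y; apply: finj; rewrite inE.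
pose P X := countable [set Y | wo_le Y X].
have vP (X : set nat) : P X -> exists x : omega1, val x = X.
  by move=> PX; exists (exist _ X PX).
have img (A : set (set nat)) : (forall X, A X -> P X) -> countable A.
  move=> AP.
  suff [g ginj] : exists g : set nat -> nat, {in A &, injective g}.
    by apply/countable_injP; exists g.
  have /choice[h hP] (X : set nat) :
    exists n, A X -> exists2 x : omega1, val x = X & f x = n.
    have [/AP/vP[x xX]|nA] := pselect (A X); last by exists 0%N.
    by exists (f x) => _; exists x.
  exists h => X Y; rewrite !inE => /hP[x xX fx] /hP[y yY fy] hXY.
  by rewrite -xX -yY; congr val; apply: finj; rewrite fx fy.
have [allP|/existsNP[X1 nPX1]] := pselect (forall X, P X).
  by apply: set_nat_uncountable; apply: img => X _; apply: allP.
have [|X0 nPX0 X0min] := @wo_le_min (~` P); first by exists X1.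
apply: nPX0; rewrite /P.
have -> : [set Y | wo_le Y X0] = \bigcup_(b in [set: bool])
    if b then [set Y | wo_le Y X0 /\ Y <> X0] else [set X0].
  apply/seteqP; split => [Y /= YX0|Y /= [[] _]]; last 2 first.
  - by case.
  - by move=> ->; have := wo_le_total X0 X0; rewrite orbb.
  - by have [YE|?] := pselect (Y = X0); [exists false|exists true].
apply: bigcup_countable => [|b _]; first exact: countableP.
case: b; last exact: countable1.
apply: img => Y [YX0 YnX0]; apply: contrapT => nPY; apply: YnX0.
by apply: wo_le_anti; rewrite YX0 X0min.
Qed.

Fact omega1_has_min : exists x : omega1, forall y, (x <= y)%O.
Proof.
have [|x _ xmin] := @omega1_wf setT; last by exists x => y; apply: xmin.
apply: contrapT => noelt; apply: omega1_uncountable.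
suff -> : [set: omega1] = set0 by exact: countable0.
by apply/seteqP; split => // x _; apply: noelt; exists x.
Qed.

Definition omega1_0 : omega1 := sval (cid omega1_has_min).

Lemma omega1_0_le (x : omega1) : (omega1_0 <= x)%O.
Proof. exact: (svalP (cid omega1_has_min)). Qed.

Section long.
Variable R : realType.

Definition ico01 : Type := {t : R | t \in `[0%R, 1%R[}.

HB.instance Definition _ := [isSub of ico01 for @sval _ _].
HB.instance Definition _ := [Choice of ico01 by <:].
HB.instance Definition _ := [SubChoice_isSubOrder of ico01 by <: with ring_display].

Fact ico01_0_subproof : (0 : R) \in `[0%R, 1%R[.
Proof. by rewrite in_itv /= lexx ltr01. Qed.

Definition ico01_0 : ico01 := exist _ 0 ico01_0_subproof.

Definition closed_long_ray : topologicalType :=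
  order_topology (omega1 *l ico01)%type.

Definition closed_long_ray0 : closed_long_ray := (omega1_0, ico01_0).

Definition long_ray : topologicalType := ~` [set closed_long_ray0].

Definition long_line : topologicalType :=
  wedge (fun _ : bool => closed_long_ray0).

End long.

Section charts.
Variables (R : realType) (M : topologicalType).

(* A homeomorphism from an open subset of M onto an open subset of the plane;
   the values of [chart_map] and [chart_inv] outside [chart_dom] and
   [chart_cod] are irrelevant. *)
Record chart := Chart {
  chart_dom : set M;
  chart_cod : set (R * R);
  chart_map : M -> R * R;
  chart_inv : R * R -> M;
  chart_dom_open : open chart_dom;
  chart_cod_open : open chart_cod;
  chart_map_cod : forall p, chart_dom p -> chart_cod (chart_map p);
  chart_inv_dom : forall z, chart_cod z -> chart_dom (chart_inv z);
  chart_mapK : forall p, chart_dom p -> chart_inv (chart_map p) = p;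
  chart_invK : forall z, chart_cod z -> chart_map (chart_inv z) = z;
  chart_map_continuous : {within chart_dom, continuous chart_map};
  chart_inv_continuous : {within chart_cod, continuous chart_inv}
}.

Definition surface : Prop :=
  [/\ connected [set: M], hausdorff_space M &
      forall p : M, exists c : chart, chart_dom c p].

(* Possibly unbounded. *)
Definition open_interval (I : set R) : Prop :=
  exists a b : \bar R, I = [set x | (a < x%:E < b)%E].

Definition open_box (B : set (R * R)) : Prop :=
  exists I J : set R, [/\ open_interval I, open_interval J & B = I `*` J].

Definition coordinate_change (c d : chart) : R * R -> R * R :=
  chart_map d \o chart_inv c.

Definition foliated_change (c d : chart) : Prop :=
  forall z, (chart_map c @` (chart_dom c `&` chart_dom d)) z ->
  exists (f : R -> R -> R) (g : R -> R), \forall w \near z,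
    coordinate_change c d w = (f w.1 w.2, g w.2).

Definition foliated_atlas (A : set chart) : Prop :=
  [/\ forall p, exists2 c, A c & chart_dom c p,
      forall c, A c -> open_box (chart_cod c) &
      forall c d, A c -> A d -> foliated_change c d].

Record foliation := Foliation {
  foliation_atlas : set chart;
  foliation_atlasP : foliated_atlas foliation_atlas;
  foliation_maximal : forall A, foliated_atlas A ->
    foliation_atlas `<=` A -> A `<=` foliation_atlas
}.

Definition plaque (c : chart) (y : R) : set M :=
  chart_dom c `&` [set p | (chart_map c p).2 = y].

Definition plaque_opens (F : foliation) : set (set M) :=
  [set S | exists c y O, [/\ foliation_atlas F c, open O & S = plaque c y `&` O]].

(* An alias of M, carrying the topology generated by [plaque_opens]. *)
Definition leaf_space (F : foliation) : Type := M.

HB.instance Definition _ (F : foliation) := Choice.on (leaf_space F).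
HB.instance Definition _ (F : foliation) :=
  @isSubBaseTopological.Build (leaf_space F) (set M) (plaque_opens F) id.

End charts.

Section leaves.
Variables (R : realType) (M : topologicalType) (F : foliation R M).

Definition is_leaf (L : set (leaf_space F)) : Prop :=
  exists x, L = connected_component [set: leaf_space F] x.

(* A leaf L coerces to the subtype of its points, with the subspace topology
   inherited from [leaf_space F]. *)
Definition long_leaf (L : set (leaf_space F)) : Prop :=
  homeomorphic L (long_ray R) \/ homeomorphic L (long_line R).

Definition embedded_leaf (L : set (leaf_space F)) : Prop :=
  forall U : set L, @open L U <-> @open (L : set M) U.

Definition minimal_foliation : Prop :=
  forall L : set (leaf_space F), is_leaf L -> @dense M L.

End leaves.

(* Main.v *)
From HB Require Import structures.
Require Import Defs.
From mathcomp Require Import finmap all_boot all_order all_algebra.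
From mathcomp Require Import all_classical all_reals all_analysis.
From mathcomp Require Import ring lra.
Import Order.TTheory GRing.Theory Num.Theory.
Import numFieldNormedType.Exports.

(** The surface is a once punctured torus into which a long ray has been
    inserted.

    The torus is the quotient of the plane by [lattice], foliated by the
    horizontal lines; every half-leaf is dense because the slope is irrational.
    Removing the lattice point [0] cuts the leaf at height [0] into the
    half-leaves [x > 0] and [x < 0]. A copy of the long ray is attached to the
    end of the latter, as a limit of curves in the punctured torus: a tower
    [(tower a)] of functions, indexed by omega1 and increasing by at least [1]
    for eventual domination ([growth_tower]), gives for each point [c] of the
    long ray beyond the first unit segment a curve
    [x = - 1 / (tower c.1 (1 / |y|) + c.2)] tending to the origin with [y], and
    [c < d] implies that the curve of [c] is to the left of that of [d] for
    small [y != 0]. The points of an interval of the long ray together with the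
    points between the curves of its ends, for small [y], form the
    neighbourhoods of the new points ([surf_open]).

    The main point is that the new points have charts, although the curves are
    ordered only near the axis and not uniformly so. For a countable ordinal
    [b], weights with sum [1] on the ordinals up to [b] turn the initial
    piece of the long ray up to [b] into a real interval: the coordinate of [c]
    is the weighted sum over [a] of the fraction of the [a]-th unit segment
    that lies before [c] ([coord]). The same weighted sum, with segments
    replaced by the strips between [tower a] and [tower a + 1], is a function
    [plane_coord] on the plane, continuous on [x < 0] and increasing along
    horizontal lines. Dominated convergence shows that along the curve of [c] it
    tends to the coordinate of [c] ([plane_coord_curve]). So both functions
    together with the height [y] form a chart ([collar_open],
    [collar_open_map]). All coordinate changes preserve heights up to a
    constant, hence the charts generate a foliation.

    Its leaves are the lines of the torus at a height different from that of the
    lattice points, the half-leaf [x > 0], and the half-leaf [x < 0] continued by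
    the long ray. The torus part is dense, so all leaves are dense, and the long
    leaf is not embedded as it accumulates on itself. The long ray is not
    separable, so it is not a real line; and the surface, which is separable but
    the union of a strictly increasing omega1-sequence of open sets, is not
    metrizable. *)

Set Implicit Arguments.
Unset Strict Implicit.
Unset Printing Implicit Defensive.
Local Open Scope classical_set_scope.
Local Open Scope ring_scope.

(** * A tower of omega1 functions under eventual domination *)

Section tower.
Variable R : realType.

(** The bound [u <= f u] is what makes the curve [x = - 1 / f (1 / |y|)] tend to
    the origin with [y]. *)
Definition growth (f : R -> R) : Prop :=
  [/\ continuous f, {homo f : u v / u <= v}, forall u, 0 <= f u
    & forall u, u <= f u].

Definition kinks (c : nat -> R) (N : nat) (u : R) : R :=
  \sum_(n < N) c n * Num.max 0 (u - n%:R).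

(** The value at [u] of the infinite sum of the terms of [kinks]: the terms of
    index above [u] vanish. *)
Definition majorant (c : nat -> R) (u : R) : R :=
  kinks c (Num.truncn u).+1 u.

Lemma kinks_stable (c : nat -> R) N u : u <= N%:R ->
  forall M, (N <= M)%N -> kinks c M u = kinks c N u.
Proof.
move=> uN; elim=> [|M IHM]; first by rewrite leqn0 => /eqP ->.
rewrite leq_eqVlt => /predU1P[-> //|NM].
rewrite /kinks big_ord_recr /= -/(kinks c M u) IHM //.
rewrite [Num.max _ _](_ : _ = 0) ?mulr0 ?addr0//; apply/max_idPl.
by rewrite subr_le0 (le_trans uN)// ler_nat.
Qed.

Lemma majorantE (c : nat -> R) N u : u <= N%:R ->
  majorant c u = kinks c N u.
Proof.
move=> uN; rewrite /majorant.
have uT : u <= (Num.truncn u).+1%:R.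
  by rewrite ltW// truncnS_gt.
have [NT|/ltnW TN] := leqP N (Num.truncn u).+1.
  by rewrite (kinks_stable c uN).
by rewrite (kinks_stable c uT TN).
Qed.

Lemma ramp_continuous (a : R) : continuous (fun v => Num.max 0 (v - a)).
Proof.
move=> v; have c0 : {for v, continuous (cst (0 : R) : R -> R)} by exact: cvg_cst.
have ca : {for v, continuous (fun v : R => v - a)}.
  by apply: cvgB; [exact: cvg_id|exact: cvg_cst].
by have := continuous_max c0 ca; apply.
Qed.

Lemma kinks_continuous (c : nat -> R) N : continuous (kinks c N).
Proof.
elim: N => [|N IHN].
  rewrite (_ : kinks c 0 = cst 0); first by move=> v; exact: cvg_cst.
  by apply/funext => v; rewrite /kinks big_ord0.
rewrite (_ : kinks c N.+1 =
    fun v => kinks c N v + c N * Num.max 0 (v - N%:R)); last first.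
  by apply/funext => v; rewrite /kinks big_ord_recr.
move=> u; apply: cvgD; first exact: IHN.
apply: cvgM; first exact: cvg_cst.
exact: ramp_continuous.
Qed.

Lemma growth_majorant (c : nat -> R) : (forall n, 1 <= c n) ->
  growth (majorant c).
Proof.
move=> c1.
have c0 n : 0 <= c n by rewrite (le_trans _ (c1 n)).
have kge0 N u : 0 <= kinks c N u.
  by apply: sumr_ge0 => n _; rewrite mulr_ge0// le_max lexx.
split.
- move=> u.
  have near_u : \forall v \near u,
      kinks c (Num.truncn u).+1 v = majorant c v.
    near=> v; rewrite (majorantE c (N := (Num.truncn u).+1))//.
    by near: v; apply: lt_le_nbhsl; exact: truncnS_gt.
  rewrite /continuous_at -(nbhs_singleton near_u).
  apply: cvg_trans; first exact: near_eq_cvg near_u.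
  exact: kinks_continuous.
- move=> u v uv; have vN : v <= (Num.truncn v).+1%:R by rewrite ltW// truncnS_gt.
  rewrite (majorantE c vN) (majorantE c (le_trans uv vN)).
  apply: ler_sum => n _; apply: ler_wpM2l => //.
  by rewrite ge_max !le_max lexx lerB// orbT.
- by move=> u; exact: kge0.
- move=> u; rewrite /majorant /kinks big_ord_recl /= subr0.
  rewrite -[leLHS]addr0 lerD//; last first.
    by apply: sumr_ge0 => n _; rewrite mulr_ge0// le_max lexx.
  apply: (@le_trans _ _ (Num.max 0 u)); first by rewrite le_max lexx orbT.
  by rewrite ler_peMl// le_max lexx.
Unshelve. all: by end_near. Qed.

(** The diagonal argument: between [n.+1] and [n.+2] only the functions of index
    at most [n] are taken care of, and the single kink at [n] suffices for that,
    being at least [c n] there. *)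
Lemma growth_dominate (f : nat -> R -> R) : (forall k, growth (f k)) ->
  exists2 g, growth g & forall k, exists N, forall u, N <= u -> f k u + 1 <= g u.
Proof.
move=> fT; pose c n : R := (\sum_(k < n.+1) f k n.+2%:R) + 1.
have f0 k u : 0 <= f k u by have [] := fT k.
have c1 n : 1 <= c n by rewrite lerDr sumr_ge0.
exists (majorant c); first exact: growth_majorant.
move=> k; exists k.+1%:R => u ku.
have u0 : 0 <= u by rewrite (le_trans _ ku).
set m := Num.truncn u.
have mu : m%:R <= u by rewrite truncn_le.
have um : u < m.+1%:R by rewrite truncnS_gt.
have km : (k < m)%N by rewrite -ltnS -(ltr_nat R) (le_lt_trans ku).
rewrite /majorant -/m.
case: m mu um km => // n mu um; rewrite ltnS => kn.
have nn2 : (n < n.+2)%N by [].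
rewrite /kinks (bigD1 (Ordinal nn2)) //= -[leLHS]addr0 lerD//; last first.
  by apply: sumr_ge0 => i _; rewrite mulr_ge0 ?le_max ?lexx// (le_trans _ (c1 _)).
have un : 1 <= Num.max 0 (u - n%:R).
  by rewrite le_max lerBrDl natr1 mu orbT.
apply: (@le_trans _ _ (c n)); last by rewrite ler_peMr// (le_trans _ (c1 _)).
rewrite lerD//.
have kn1 : (k < n.+1)%N by [].
apply: (@le_trans _ _ (f k n.+2%:R)).
  by have [_ + _ _] := fT k; apply; exact: ltW.
by rewrite (bigD1 (Ordinal kn1))//= lerDl sumr_ge0.
Qed.

Lemma omega1_lt_wf : well_founded (fun a b : omega1 => (a < b)%O).
Proof.
move=> a; apply: contrapT => na.
have [|m nm mmin] := @omega1_wf [set x | ~ Acc (fun a b => (a < b)%O) x].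
  by exists a.
apply: nm; constructor=> b bm; apply: contrapT => /mmin.
by rewrite leNgt bm.
Qed.

Lemma omega1_enum (b : omega1) :
  exists h : nat -> omega1, range h = [set a | (a <= b)%O].
Proof.
have /pfcard_geP[b0|/surjfunPex[h hP]] := omega1_countable_initial b.
  have bb : [set a : omega1 | (a <= b)%O] b by exact: lexx.
  by rewrite b0 in bb.
by exists h.
Qed.

(** By transfinite recursion, each function dominating the countably many
    previous ones. A gap of [1] is kept between consecutive functions: it will
    receive a unit segment of the long ray. *)
Lemma growth_tower : exists g : omega1 -> R -> R,
  (forall a, growth (g a)) /\
  forall a b, (a < b)%O -> exists N, forall u, N <= u -> g a u + 1 <= g b u.
Proof.
have /choice[enum enumP] := omega1_enum.
have growth0 : growth (majorant (cst 1)) by apply: growth_majorant => n.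
have /choice[dom domP] : forall f : nat -> R -> R, exists g,
    (forall k, growth (f k)) -> growth g /\
    forall k, exists N, forall u, N <= u -> f k u + 1 <= g u.
  move=> f; have [fT|nfT] := pselect (forall k, growth (f k)).
    by have [g gT gP] := growth_dominate fT; exists g.
  by exists (majorant (cst 1)).
(* The enumeration of [a <= b] also lists [b], where a default value stands. *)
pose earlier b (rec : forall a, (a < b)%O -> R -> R) k : R -> R :=
  if pselect (enum b k < b)%O is left ab then rec _ ab else majorant (cst 1).
pose step b rec := dom (earlier b rec).
pose g := Fix omega1_lt_wf (fun=> R -> R) step.
have gE b : g b = step b (fun a _ => g a).
  apply: Fix_eq => x f f' ff'; congr (dom _); apply/funext => k.
  by rewrite /earlier; case: pselect => // ab; rewrite ff'.
have gT b : growth (g b).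
  elim: (omega1_lt_wf b) => {}b _ IHb; rewrite gE /step.
  have [|//] := domP (earlier b (fun a _ => g a)).
  by move=> k; rewrite /earlier; case: pselect => // ab; apply: IHb.
exists g; split => // a b ab.
have [|_ domb] := domP (earlier b (fun a _ => g a)).
  by move=> k; rewrite /earlier; case: pselect.
have [k _ ka] : range (enum b) a by rewrite enumP /= ltW.
have [N NP] := domb k; exists N => u /NP; rewrite (gE b) /step.
by rewrite {1}/earlier; case: pselect; rewrite ka.
Qed.

End tower.

(** * Weighted averages over a countable set *)

Section average.
Variables (R : realType) (I : Type) (h : nat -> I).

Definition weight (n : nat) : R := geometric 2^-1 2^-1 n.

(** The mean of [k] for the probability measure with mass [weight n] at [h n].
    The enumeration [h] may repeat itself. *)
Definition average (k : I -> R) : R := limn (series (fun n => weight n * k (h n))).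

Definition unit_valued (k : I -> R) : Prop := forall a, 0 <= k a <= 1.

Lemma weight_gt0 n : 0 < weight n.
Proof. by rewrite /weight /= mulr_gt0// exprn_gt0. Qed.

Lemma cvg_weight : series weight @ \oo --> (1 : R).
Proof.
have -> : 1 = 2^-1 * (1 - 2^-1)^-1 :> R by field.
by apply: cvg_geometric_series; rewrite ger0_norm ?invr_ge0// invf_lt1// ltr1n.
Qed.

Lemma series_weight N : series weight N = 1 - 2^-1 ^+ N :> R.
Proof. by rewrite geometric_seriesE /=; [field|rewrite lt_eqF// invf_lt1// ltr1n]. Qed.

Lemma average_cvg k : unit_valued k ->
  series (fun n => weight n * k (h n)) @ \oo --> average k.
Proof.
move=> k01; apply: (@series_le_cvg _ _ weight).
- by move=> n; rewrite mulr_ge0 ?(ltW (weight_gt0 n))//; case/andP: (k01 (h n)).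
- by move=> n; exact/ltW/weight_gt0.
- by move=> n; rewrite ler_piMr ?(ltW (weight_gt0 n))//; case/andP: (k01 (h n)).
- by apply/cvg_ex; exists 1; exact: cvg_weight.
Qed.

Lemma eq_average k l : (forall n, k (h n) = l (h n)) -> average k = average l.
Proof.
by move=> kl; congr (limn (series _)); apply/funext => n; rewrite kl.
Qed.

Lemma average1 : average (fun=> 1) = 1.
Proof.
apply/cvg_lim => //; under eq_fun do rewrite mulr1.
exact: cvg_weight.
Qed.

Lemma averageDZ k l c : unit_valued k -> unit_valued l ->
  average (fun a => k a + c * l a) = average k + c * average l.
Proof.
move=> k01 l01; apply/cvg_lim => //.
rewrite (_ : series _ = fun N =>
    series (fun n => weight n * k (h n)) N +
    c * series (fun n => weight n * l (h n)) N); last first.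
  apply/funext => N; rewrite /series /= big_distrr/= -big_split/=.
  by apply: eq_bigr => n _; rewrite mulrDr mulrCA.
apply: cvgD; first exact: average_cvg.
by apply: cvgM; [exact: cvg_cst|exact: average_cvg].
Qed.

Lemma average0 : average (fun=> 0) = 0.
Proof.
have -> : (fun=> 0) = (fun a : I => 1 + -1 * 1) :> (I -> R).
  by apply/funext => a; lra.
by rewrite (averageDZ (k := fun=> 1) (l := fun=> 1)) => [|a|a]; rewrite ?average1; lra.
Qed.

Lemma average_ge_partial k N : unit_valued k ->
  series (fun n => weight n * k (h n)) N <= average k.
Proof.
move=> k01; apply: nondecreasing_cvgn_le; last first.
  by apply/cvg_ex; exists (average k); exact: average_cvg.
apply: nondecreasing_series => n _ _.
by rewrite mulr_ge0 ?(ltW (weight_gt0 n))//; case/andP: (k01 (h n)).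
Qed.

(** The upper estimate is the lower one applied to [1 - k]. *)
Lemma average_le_partial k N : unit_valued k ->
  average k <= series (fun n => weight n * k (h n)) N + 2^-1 ^+ N.
Proof.
move=> k01.
have c01 : unit_valued (fun a => 1 + -1 * k a).
  by move=> a; have := k01 a; lra.
have := average_ge_partial N c01.
rewrite averageDZ => [|a|//]; last by lra.
rewrite average1.
rewrite (_ : series _ N =
    series weight N - series (fun n => weight n * k (h n)) N); last first.
  rewrite /series /= -sumrB; apply: eq_bigr => n _; lra.
rewrite series_weight; lra.
Qed.

Lemma average_lt k l n : unit_valued k -> unit_valued l ->
  (forall a, k a <= l a) -> k (h n) < l (h n) -> average k < average l.
Proof.
move=> k01 l01 kl klhn.
have d01 : unit_valued (fun a => l a + -1 * k a).
  by move=> a; have := k01 a; have := l01 a; have := kl a; lra.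
have := average_ge_partial n.+1 d01.
rewrite averageDZ// /series /= big_nat_recr//=.
have : 0 < weight n * (l (h n) + -1 * k (h n)).
  by rewrite mulr_gt0 ?weight_gt0//; lra.
have : 0 <= \sum_(0 <= i < n) weight i * (l (h i) + -1 * k (h i)).
  apply: sumr_ge0 => i _; rewrite mulr_ge0 ?(ltW (weight_gt0 i))//.
  by case/andP: (d01 (h i)).
lra.
Qed.

Lemma average_le k l : unit_valued k -> unit_valued l ->
  (forall a, k a <= l a) -> average k <= average l.
Proof.
move=> k01 l01 kl.
have d01 : unit_valued (fun a => l a + -1 * k a).
  by move=> a; have := k01 a; have := l01 a; have := kl a; lra.
have := average_ge_partial 0 d01.
rewrite averageDZ// /series /= big_nil; lra.
Qed.

(** Dominated convergence: pointwise convergence on the enumerated set is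
    enough, since the tails of the sums are uniformly small. *)
Lemma average_continuous {X : Type} (F : set_system X) {FF : Filter F}
    (k : X -> I -> R) (l : I -> R) :
  (\forall x \near F, unit_valued (k x)) -> unit_valued l ->
  (forall n, k x (h n) @[x --> F] --> l (h n)) ->
  average (k x) @[x --> F] --> average l.
Proof.
move=> k01 l01 kl; apply/cvgrPdist_lt => e e0.
have [N Ne] : exists N, 2^-1 ^+ N < e / 3 :> R.
  have : (fun N => 2^-1 ^+ N : R) @ \oo --> 0.
    rewrite exprn_geometric; apply: cvg_geometric.
    by rewrite ger0_norm ?invr_ge0// invf_lt1// ltr1n.
  move=> /cvgrPdist_lt /(_ (e / 3)) [|N _ /(_ N (leqnn N))]; first lra.
  by rewrite sub0r normrN ger0_norm ?exprn_ge0 ?invr_ge0//; exists N.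
have : series (fun n => weight n * k x (h n)) N @[x --> F] -->
    series (fun n => weight n * l (h n)) N.
  rewrite /series /=; elim: {Ne} N => [|N IHN].
    by under eq_fun do rewrite big_nil; rewrite big_nil; exact: cvg_cst.
  under eq_fun do rewrite big_nat_recr//=.
  rewrite big_nat_recr//=; apply: cvgD => //.
  by apply: cvgM; [exact: cvg_cst|exact: kl].
move=> /cvgrPdist_lt /(_ (e / 3)) H; near=> x.
have k01x : unit_valued (k x) by near: x.
have := average_ge_partial N k01x; have := average_le_partial N k01x.
have := average_ge_partial N l01; have := average_le_partial N l01.
have : `|series (fun n => weight n * l (h n)) N -
         series (fun n => weight n * k x (h n)) N| < e / 3.
  by near: x; apply: H; lra.
rewrite !ltr_norml; lra.
Unshelve. all: by end_near. Qed.

End average.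

(** * Coordinates along the long ray *)

Section long_coordinate.
Variable R : realType.
Implicit Types (c d : closed_long_ray R) (a b : omega1).

Lemma long_ltP c d :
  (c < d)%O <-> (c.1 < d.1)%O \/ c.1 = d.1 /\ val c.2 < val d.2.
Proof.
case: c d => [a s] [b t]; rewrite [(_ < _)%O]ltxi_pair /=.
split.
  move=> /andP[ab /implyP st]; have [ltab|ba] := ltP a b; first by left.
  by right; split; [apply/le_anti; rewrite ab|exact: st].
move=> [ab|[-> st]]; last by rewrite lexx/=; exact: st.
by rewrite ltW//= leNgt ab.
Qed.

Lemma ico_ge0 c : 0 <= val c.2.
Proof. by have := valP c.2; rewrite /= in_itv /= => /andP[]. Qed.

Lemma ico_lt1 c : val c.2 < 1.
Proof. by have := valP c.2; rewrite /= in_itv /= => /andP[]. Qed.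

(** [t] is meant to lie in [0 <= t < 1]; otherwise the second component is [0]. *)
Definition mk_long a (t : R) : closed_long_ray R := (a, insubd (ico01_0 R) t).

Lemma mk_longK a t : 0 <= t < 1 -> val (mk_long a t).2 = t.
Proof. by move=> t01; apply: insubdK; rewrite /= in_itv. Qed.

(** The fraction of the [a]-th unit segment of the long ray that precedes [c]. *)
Definition long_passage c a : R :=
  if (a < c.1)%O then 1 else if a == c.1 then val c.2 else 0.

Lemma long_passage_unit c : unit_valued (long_passage c).
Proof.
move=> a; rewrite /long_passage; case: ifP => _; first lra.
by case: ifP => _; have := ico_ge0 c; have := ico_lt1 c; lra.
Qed.

Lemma long_passage_le c d a : (c <= d)%O -> long_passage c a <= long_passage d a.
Proof.
rewrite le_eqVlt => /predU1P[-> //|/long_ltP]; rewrite /long_passage.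
have := ico_ge0 c; have := ico_lt1 c; have := ico_ge0 d; have := ico_lt1 d.
move=> d1 d0 c1 c0 [cd|[<- cd]]; last first.
  by case: ifP => // _; case: ifP => // _; exact: ltW.
have [ac|ca|->] := ltgtP a c.1.
- by rewrite (lt_trans ac cd).
- by case: ifP => // _; case: ifP.
- by rewrite cd; lra.
Qed.

Lemma long_passage_lt c d : (c < d)%O -> long_passage c c.1 < long_passage d c.1.
Proof.
move=> /long_ltP; rewrite /long_passage ltxx eqxx.
move=> [->|[<- cd]]; first exact: ico_lt1.
by rewrite ltxx eqxx.
Qed.

Variables (h : nat -> omega1) (b : omega1).
Hypothesis hP : range h = [set a | (a <= b)%O].

(** The measure of the part of the long ray before [c], when the [a]-th unit
    segment carries the total weight of [a] in the enumeration [h]. It is an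
    order isomorphism from the part of the long ray with first component at most
    [b] onto a real interval, and constant beyond. *)
Definition coord c : R := average h (long_passage c).

Lemma enum_index a : (a <= b)%O -> exists n, h n = a.
Proof.
move=> ab; have [n _ <-] : range h a; [by rewrite hP|by exists n].
Qed.

Lemma enum_le n : (h n <= b)%O.
Proof.
have : range h (h n) by exists n.
by rewrite hP.
Qed.

Lemma coord_le c d : (c <= d)%O -> coord c <= coord d.
Proof. by move=> cd; apply: average_le => *; [exact: long_passage_unit..|exact: long_passage_le]. Qed.

Lemma coord_ge0 c : 0 <= coord c.
Proof.
have := average_ge_partial h 0 (long_passage_unit c).
by rewrite /series /= big_nil.
Qed.

Lemma coord_lt c d : (c.1 <= b)%O -> (c < d)%O -> coord c < coord d.
Proof.
move=> /enum_index[n hn] cd.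
apply: (@average_lt _ _ _ _ _ n); [exact: long_passage_unit..| |].
  by move=> a; apply: long_passage_le; exact: ltW.
by rewrite hn; exact: long_passage_lt.
Qed.

Lemma coord_lt1 c : (c.1 <= b)%O -> coord c < 1.
Proof.
move=> /enum_index[n hn]; rewrite -(average1 R h).
apply: (@average_lt _ _ _ _ _ n); first exact: long_passage_unit.
- by move=> a; rewrite ler01 lexx.
- by move=> a; case/andP: (long_passage_unit c a).
- by rewrite hn /long_passage ltxx eqxx; exact: ico_lt1.
Qed.

(** If [a] is the least ordinal up to which the weights sum up to more than [v],
    then the weights strictly below [a] sum up to at most [v]: a finite partial
    sum exceeding [v] would only involve indices up to some [a' < a]. The value
    [v] is then reached inside the [a]-th segment. *)
Lemma coord_surj v : 0 <= v < 1 ->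
  exists2 c : closed_long_ray R, (c.1 <= b)%O & coord c = v.
Proof.
move=> /andP[v0 v1].
pose upto a a' : R := (a' <= a)%O%:R; pose below a a' : R := (a' < a)%O%:R.
have upto01 a : unit_valued (upto a).
  by move=> a'; rewrite /upto ler0n lern1 leq_b1.
have below01 a : unit_valued (below a).
  by move=> a'; rewrite /below ler0n lern1 leq_b1.
have [|a /= va amin] := @omega1_wf [set a | v < average h (upto a)].
  exists b => /=; rewrite (@eq_average _ _ _ _ (fun=> 1)) ?average1// => n.
  by rewrite /upto enum_le.
have ab : (a <= b)%O.
  apply: amin; rewrite /= (@eq_average _ _ _ _ (fun=> 1)) ?average1// => n.
  by rewrite /upto enum_le.
have belowv : average h (below a) <= v.
  rewrite leNgt; apply/negP => vb.
  have [N vN] : exists N, v < series (fun n => weight R n * below a (h n)) N.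
    have /cvgrPdist_lt := average_cvg (h := h) (below01 a).
    move=> /(_ (average h (below a) - v)) [|N _ /(_ N (leqnn N)) /=]; first lra.
    by rewrite ltr_norml => ?; exists N; lra.
  have [none|[a' a'a hle]] : (forall n, (n < N)%N -> ~~ (h n < a)%O) \/
      exists2 a', (a' < a)%O &
        forall n, (n < N)%N -> (h n < a)%O -> (h n <= a')%O.
    elim: {vN} N => [|N [none|[a' a'a hle]]]; first by left.
      have [ha|nha] := boolP (h N < a)%O; last first.
        left=> n; rewrite ltnS leq_eqVlt => /predU1P[-> //|]; exact: none.
      right; exists (h N) => // n; rewrite ltnS leq_eqVlt => /predU1P[-> //|].
      by move=> /none /negP.
    right; have [ha|nha] := boolP (h N < a)%O; last first.
      exists a' => // n; rewrite ltnS leq_eqVlt => /predU1P[->|]; last exact: hle.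
      by move=> ha; rewrite ha in nha.
    exists (Order.max a' (h N)); first by rewrite gt_max a'a.
    move=> n; rewrite ltnS leq_eqVlt => /predU1P[->|nN].
      by rewrite le_max lexx orbT.
    by move=> /(hle _ nN) hna; rewrite le_max hna.
  - suff : series (fun n => weight R n * below a (h n)) N = 0 by lra.
    rewrite /series /= big_nat big1// => n nN.
    by rewrite /below (negPf (none _ nN)) mulr0.
  - suff /amin : v < average h (upto a') by rewrite leNgt a'a.
    apply: (lt_le_trans vN).
    apply: le_trans (average_ge_partial h N (upto01 a')).
    rewrite /series /= !big_nat; apply: ler_sum => n nN.
    rewrite ler_wpM2l ?(ltW (weight_gt0 _ _))//.
    rewrite /below /upto; case: ltP => [ha|_]; last by rewrite ler0n.
    by rewrite hle.
pose at_a a' : R := (a' == a)%:R.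
have at01 : unit_valued at_a by move=> a'; rewrite /at_a ler0n lern1 leq_b1.
have uptoE : average h (upto a) = average h (below a) + 1 * average h at_a.
  rewrite -averageDZ//; apply: eq_average => n; rewrite /upto /below /at_a.
  by rewrite le_eqVlt; case: ltgtP => _ /=; lra.
pose w := average h at_a; have w0 : 0 < w by rewrite /w; lra.
pose t := (v - average h (below a)) / w.
have t01 : 0 <= t < 1.
  by rewrite /t ltr_pdivrMr// divr_ge0 ?(ltW w0)//=; [rewrite /w; lra|lra].
exists (mk_long a t) => //.
have -> : v = average h (below a) + t * w.
  by rewrite /t divfK ?gt_eqF//; lra.
rewrite -averageDZ//; apply: eq_average => n.
rewrite /long_passage mk_longK// /below /at_a /=.
by case: ltgtP => _ /=; rewrite ?mulr0 ?mulr1 ?addr0 ?add0r.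
Qed.

End long_coordinate.

(** * Stretching the plane along the tower *)

Section near_product.
Variables (S T : topologicalType) (z : S * T).

Lemma near_fst (P : set S) : (\forall x \near z.1, P x) -> \forall w \near z, P w.1.
Proof.
by move=> zP; exists (P, setT) => [|w [] //]; split => //; exact: filterT.
Qed.

Lemma near_snd (P : set T) : (\forall y \near z.2, P y) -> \forall w \near z, P w.2.
Proof.
by move=> zP; exists (setT, P) => [|w [] //]; split => //; exact: filterT.
Qed.

End near_product.

Section plane_coordinate.
Variable R : realType.
Implicit Types (c d : closed_long_ray R) (a b : omega1) (z : R * R).

Definition tower : omega1 -> R -> R := sval (cid (growth_tower R)).

Lemma growth_towerE a : growth (tower a).
Proof. by have [+ _] := svalP (cid (growth_tower R)); apply. Qed.

Lemma tower_lt a b : (a < b)%O ->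
  exists N, forall u, N <= u -> tower a u + 1 <= tower b u.
Proof. by have [_ +] := svalP (cid (growth_tower R)); apply. Qed.

Lemma tower_ge a u : u <= tower a u.
Proof. by have [_ _ _ +] := growth_towerE a; apply. Qed.

Definition clip (v : R) : R := Num.max 0 (Num.min 1 v).

Lemma clip_unit v : 0 <= clip v <= 1.
Proof. by rewrite /clip le_max lexx ge_max ler01 ge_min lexx. Qed.

Lemma clip_le v w : v <= w -> clip v <= clip w.
Proof.
move=> vw; rewrite /clip ge_max !le_max lexx /=; apply/orP; right.
by rewrite le_min !ge_min lexx vw orbT.
Qed.

Lemma clip0 v : v <= 0 -> clip v = 0.
Proof. by move=> v0; apply/max_idPl; rewrite ge_min v0 orbT. Qed.

Lemma clip1 v : 1 <= v -> clip v = 1.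
Proof. by move=> v1; rewrite /clip (min_idPl v1); exact/max_idPr/ler01. Qed.

Lemma clip_id v : 0 <= v <= 1 -> clip v = v.
Proof. by move=> /andP[v0 v1]; rewrite /clip (min_idPr v1); exact/max_idPr. Qed.

Lemma clip_continuous : continuous clip.
Proof.
move=> v.
have c1 : {for v, continuous (cst (1 : R) : R -> R)} by exact: cvg_cst.
have c0 : {for v, continuous (cst (0 : R) : R -> R)} by exact: cvg_cst.
have cid : {for v, continuous (id : R -> R)} by exact: cvg_id.
by have := continuous_max c0 (continuous_min c1 cid); apply.
Qed.

(** The plane analogue of [long_passage]: the fraction of the [a]-th strip, one
    unit wide in the coordinate [- 1 / x], that lies to the left of [z] on its
    horizontal line. For the first ordinal the strip is the whole half-line
    [x < 0], measured by [1 / (1 - x)]. As [y] tends to [0] with [x < 0] fixed,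
    all other strips are still to come, whence the value [0] on the axis. *)
Definition passage z a : R :=
  if a == omega1_0 then (1 - z.1)^-1
  else if z.2 == 0 then 0 else clip (- z.1^-1 - tower a `|z.2|^-1).

(** The coordinate [- 1 / x] at height [y] of the curve that will converge to the
    point [c] of the long ray. *)
Definition depth c (y : R) : R :=
  if c.1 == omega1_0 then val c.2 / (1 - val c.2)
  else tower c.1 `|y|^-1 + val c.2.

Definition curve c (y : R) : R := - (depth c y)^-1.

Lemma passage_unit z : z.1 < 0 -> unit_valued (passage z).
Proof.
move=> z0 a; rewrite /passage; case: eqP => _.
  rewrite invr_ge0 invf_le1; last by lra.
  by apply/andP; split; lra.
by case: eqP => _; [lra|exact: clip_unit].
Qed.

Lemma passage_le x x' y a : x <= x' -> x' < 0 -> passage (x, y) a <= passage (x', y) a.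
Proof.
move=> xx' x'0; rewrite /passage /=; case: eqP => _.
  by rewrite lef_pV2 ?posrE; lra.
case: eqP => _ //; apply: clip_le; rewrite lerB// lerN2 lef_nV2 ?negrE//.
exact: le_lt_trans x'0.
Qed.

Lemma near_inv_ge (N : R) : \forall y \near (0 : R)^', N <= `|y|^-1.
Proof.
near=> y; have y0 : 0 < `|y|.
  by rewrite normr_gt0; near: y; exact: nbhs_dnbhs_neq.
have : `|y| < (Num.max N 1)^-1.
  near: y; apply: dnbhs0_lt; rewrite invr_gt0 lt_max ltr01 orbT//.
rewrite -[X in X < _]invrK ltf_pV2 ?posrE ?invr_gt0// ?lt_max ?ltr01 ?orbT//.
by move=> /ltW; apply: le_trans; rewrite le_max lexx.
Unshelve. all: by end_near. Qed.

(** On the axis continuity holds because [tower a] is at least the identity: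
    [- 1 / x] stays bounded near [z] while [tower a (1 / |y|)] is unbounded. *)
Lemma passage_continuous z a : z.1 < 0 -> {for z, continuous (passage ^~ a)}.
Proof.
move=> z0; rewrite /passage; case: eqP => _.
  apply: cvgV; first by rewrite gt_eqF//; lra.
  by apply: cvgB; [exact: cvg_cst|exact: cvg_fst].
have [y0|y0] := eqVneq z.2 0; last first.
  have near_z : \forall w \near z,
      clip (- w.1^-1 - tower a `|w.2|^-1) =
      if w.2 == 0 then 0 else clip (- w.1^-1 - tower a `|w.2|^-1).
    have : \forall w \near z, w.2 != 0.
      apply: (@near_snd _ _ z (fun y => y != 0)); exact: cvgr_neq0 cvg_id y0.
    by apply: filterS => w /negPf ->.
  rewrite /continuous_at.
  apply: cvg_trans; first exact: near_eq_cvg near_z.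
  rewrite (negPf y0); apply: (@continuous_cvg _ _ _ _ _
    (fun w : R * R => - w.1^-1 - tower a `|w.2|^-1) clip); first exact: clip_continuous.
  apply: cvgB.
    apply: cvgN; apply: cvgV; first by rewrite lt_eqF.
    exact: cvg_fst.
  apply: (@continuous_cvg _ _ _ _ _ (fun w : R * R => `|w.2|^-1) (tower a)).
    by have [+ _ _ _] := growth_towerE a; apply.
  apply: cvgV; first by rewrite normr_eq0.
  by apply: cvg_norm; exact: cvg_snd.
have near_z : \forall w \near z,
    0 = if w.2 == 0 then 0 else clip (- w.1^-1 - tower a `|w.2|^-1).
  have n1 : \forall w \near z, w.1 < z.1 / 2.
    by apply: (@near_fst _ _ z (fun x => x < z.1 / 2)); apply: lt_nbhsl; lra.
  have n2 : \forall w \near z, w.2 != 0 -> - (2 / z.1) <= `|w.2|^-1.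
    apply: (@near_snd _ _ z (fun y => y != 0 -> - (2 / z.1) <= `|y|^-1)).
    rewrite y0.
    by have := near_inv_ge (- (2 / z.1)); rewrite /dnbhs /within.
  near=> w; case: eqP => // /eqP w0; rewrite clip0// subr_le0.
  apply: le_trans (tower_ge _ _).
  apply: (@le_trans _ _ (- (2 / z.1))); last by move: w0; near: w.
  have w1 : w.1 < z.1 / 2 by near: w.
  by rewrite lerN2 -[2 / z.1]invrK invf_div lef_nV2 ?negrE ?ltW//; lra.
rewrite /continuous_at; apply: cvg_trans.
  exact: (near_eq_cvg (f := cst 0) near_z).
by rewrite y0 eqxx; exact: cvg_cst.
Unshelve. all: by end_near. Qed.

Definition long0 : closed_long_ray R := closed_long_ray0 R.

Lemma long0_lt c : (long0 < c)%O -> c.1 = omega1_0 -> 0 < val c.2.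
Proof. by move=> /long_ltP[/= + c0|[_ //]]; rewrite c0 ltxx. Qed.

Lemma depth_gt0 c y : (long0 < c)%O -> y != 0 -> 0 < depth c y.
Proof.
move=> c0 y0; rewrite /depth; have := ico_ge0 c; have := ico_lt1 c.
case: eqP => [/(long0_lt c0) ? ? ?|_ ? ?]; first by rewrite divr_gt0//; lra.
rewrite ltr_wpDr//; apply: lt_le_trans (tower_ge _ _).
by rewrite invr_gt0 normr_gt0.
Qed.

Lemma curve_lt0 c y : (long0 < c)%O -> y != 0 -> curve c y < 0.
Proof. by move=> c0 y0; rewrite oppr_lt0 invr_gt0 depth_gt0. Qed.

Lemma curve_long c y : c.1 != omega1_0 -> y != 0 -> - `|y| <= curve c y.
Proof.
move=> c1 y0; rewrite /curve /depth (negPf c1) lerN2 -[leRHS]invrK.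
have yp : 0 < `|y|^-1 by rewrite invr_gt0 normr_gt0.
have : `|y|^-1 <= tower c.1 `|y|^-1 + val c.2.
  by rewrite -[leLHS]addr0 lerD ?tower_ge ?ico_ge0.
by move=> le; rewrite lef_pV2 ?posrE ?(lt_le_trans yp).
Qed.

(** The points of the first unit segment are those of the half-leaf [x < 0] of the
    plane, and their curves are vertical lines. *)
Lemma curve0 c y : c.1 = omega1_0 -> 0 < val c.2 -> curve c y = 1 - (val c.2)^-1.
Proof.
move=> c1 t0; rewrite /curve /depth c1 eqxx; have := ico_lt1 c => t1.
by field; rewrite subr_eq0 gt_eqF// gt_eqF.
Qed.

(** The curve of [c] has, in the limit, passed the same strips as [c] has passed
    segments: [tower a] and [tower c.1] are eventually at least [1] apart, and the
    clipping forgets how far. *)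
Lemma passage_curve c a : (long0 < c)%O ->
  passage (curve c y, y) a @[y --> (0 : R)^'] --> long_passage c a.
Proof.
move=> c0; have c_ge0 := ico_ge0 c; have c_lt1 := ico_lt1 c.
rewrite /passage /long_passage /=; have [->|a0] := eqVneq a omega1_0.
  have [c1|c1] := eqVneq omega1_0 c.1.
    rewrite -c1 ltxx; under eq_fun do rewrite curve0 ?long0_lt// subKr invrK.
    exact: cvg_cst.
  rewrite lt_neqAle c1 omega1_0_le /=.
  rewrite -[X in _ --> X]invr1; apply: cvgV => //.
  rewrite -[X in _ --> X]subr0; apply: cvgB; first exact: cvg_cst.
  apply/cvgrPdist_le => e e0; near=> y.
  have y0 : y != 0 by near: y; exact: nbhs_dnbhs_neq.
  rewrite sub0r normrN ltr0_norm ?curve_lt0// lerNl.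
  apply: le_trans (curve_long _ y0); last by rewrite eq_sym.
  rewrite lerN2; near: y; exact: dnbhs0_le.
have [N NP] : exists N, forall u, N <= u ->
    ((a < c.1)%O -> tower a u + 1 <= tower c.1 u) /\
    ((c.1 < a)%O -> tower c.1 u + 1 <= tower a u).
  case: (ltgtP a c.1) => [/tower_lt[N NP]|/tower_lt[N NP]|_].
  - by exists N => u /NP.
  - by exists N => u /NP.
  - by exists 0.
apply: cvg_near_cst; near=> y.
have y0 : y != 0 by near: y; exact: nbhs_dnbhs_neq.
rewrite (negPf y0) /curve invrN opprK invrK.
have [c1|c1] := eqVneq c.1 omega1_0.
  rewrite c1 (negPf a0) ltNge omega1_0_le /= clip0// subr_le0 /depth c1 eqxx.
  by apply: le_trans (tower_ge _ _); near: y; exact: near_inv_ge.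
rewrite /depth (negPf c1).
have [lt_ac lt_ca] : ((a < c.1)%O -> tower a `|y|^-1 + 1 <= tower c.1 `|y|^-1) /\
    ((c.1 < a)%O -> tower c.1 `|y|^-1 + 1 <= tower a `|y|^-1).
  by apply: NP; near: y; exact: near_inv_ge.
case: ltgtP lt_ac lt_ca => [ac /(_ isT) le _|ca _ /(_ isT) le|-> _ _].
- by rewrite clip1//; lra.
- by rewrite clip0//; lra.
- by rewrite addrAC subrr add0r clip_id// c_ge0 ltW.
Unshelve. all: by end_near. Qed.

Variables (h : nat -> omega1) (b : omega1).
Hypothesis hP : range h = [set a | (a <= b)%O].

(** Together with [coord] on the long ray, this will be the coordinate along the
    leaves in the charts at the new points. *)
Definition plane_coord z : R := average h (passage z).

Lemma plane_coord_continuous z : z.1 < 0 -> {for z, continuous plane_coord}.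
Proof.
move=> z0; apply: average_continuous; last by move=> n; exact: passage_continuous.
  have : \forall w \near z, w.1 < 0.
    by apply: (@near_fst _ _ z (fun x => x < 0)); exact: lt_nbhsl.
  by apply: filterS => w; exact: passage_unit.
exact: passage_unit.
Qed.

Lemma plane_coord_lt x x' y : x < x' -> x' < 0 -> plane_coord (x, y) < plane_coord (x', y).
Proof.
move=> xx' x'0; have x0 : x < 0 by exact: lt_trans x'0.
have [n hn] := enum_index hP (omega1_0_le b).
apply: (@average_lt _ _ _ _ _ n); [exact: passage_unit..| |].
  by move=> a; exact/passage_le/x'0/ltW.
by rewrite hn /passage eqxx /= ltf_pV2 ?posrE; lra.
Qed.

Lemma plane_coord_curve c : (long0 < c)%O ->
  plane_coord (curve c y, y) @[y --> (0 : R)^'] --> coord h c.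
Proof.
move=> c0; apply: average_continuous; last by move=> n; exact: passage_curve.
  near=> y; apply/passage_unit/curve_lt0 => //.
  by near: y; exact: nbhs_dnbhs_neq.
exact: long_passage_unit.
Unshelve. all: by end_near. Qed.

Lemma plane_coord_axis c : c.1 = omega1_0 -> 0 < val c.2 ->
  plane_coord (1 - (val c.2)^-1, 0) = coord h c.
Proof.
move=> c1 t0; apply: eq_average => n; rewrite /passage /long_passage c1 /= eqxx.
by rewrite subKr invrK ltNge omega1_0_le /=; case: eqP.
Qed.

End plane_coordinate.

(** * A dense lattice direction *)

Section lattice.
Variable R : realType.
Implicit Types (z w : R * R).

Definition sqrt2 : R := Num.sqrt 2.

(** The quotient of the plane by this lattice is a torus, on which the horizontal
    lines induce a foliation of irrational slope. *)
Definition lattice : set (R * R) :=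
  [set z | exists n m : int, z = (n%:~R, n%:~R * sqrt2 + m%:~R)].

Lemma latticeN z : lattice z -> lattice (- z).
Proof.
move=> [n [m ->]]; exists (- n), (- m).
by rewrite !rmorphN/= mulNr -opprD.
Qed.

Lemma latticeD z w : lattice z -> lattice w -> lattice (z + w).
Proof.
move=> [n [m ->]] [n' [m' ->]]; exists (n + n'), (m + m').
by rewrite !rmorphD/= mulrDl; congr (_, _); rewrite addrACA.
Qed.

Lemma latticeB z w : lattice z -> lattice w -> lattice (z - w).
Proof. by move=> lz /latticeN; exact: latticeD. Qed.

Lemma latticeBC z w : lattice (z - w) -> lattice (w - z).
Proof. by move=> /latticeN; rewrite opprB. Qed.

Lemma int_small (n : int) : `|n%:~R| < 1 :> R -> n = 0.
Proof.
by rewrite -intr_norm ltrz1 => n1; apply/eqP; rewrite -normr_le0 -ltzD1 add0r.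
Qed.

Lemma lattice_discrete z : lattice z -> `|z.1| < 1 -> `|z.2| < 1 -> z = 0.
Proof.
move=> [n [m ->]] /= /int_small ->; rewrite mul0r add0r => /int_small ->.
by [].
Qed.

Lemma sqrt2_irrational (n m : int) : n%:~R * sqrt2 + m%:~R = 0 :> R -> n = 0.
Proof.
move=> /eqP; rewrite addr_eq0 => /eqP /(congr1 (fun x => x ^+ 2)).
rewrite exprMn sqr_sqrtr ?ler0n// sqrrN.
rewrite -!(rmorphXn (intmul 1)) /= -[2]/(2%:~R) -intrM => /eqP.
rewrite eqr_int => /eqP /(congr1 (fun k : int => `|k|%N)).
rewrite abszM !abszX /= => nm; apply/eqP; rewrite -absz_eq0.
have [//|n0] := posnP `|n|%N.
have m0 : (0 < `|m|)%N.
  rewrite lt0n; apply/eqP => m0; move: nm; rewrite m0 => /eqP.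
  by rewrite muln_eq0 expn_eq0 /= orbF -leqn0 leqNgt n0.
have /(congr1 (odd \o logn 2)) := nm; rewrite /= lognM ?expn_gt0 ?n0// !lognX.
by rewrite (_ : logn 2 (1 + 1) = 1%N)// oddD !oddM.
Qed.

Lemma lattice_horizontal z : lattice z -> z.2 = 0 -> z = 0.
Proof.
move=> lz z2; apply: lattice_discrete => //; last by rewrite z2 normr0.
by have [n [m zE]] := lz; move: z2; rewrite zE /= => /sqrt2_irrational ->; rewrite normr0.
Qed.

(** The heights of the lattice form the ring generated by [sqrt2], which contains
    the powers of [sqrt2 - 1]. *)
Lemma lattice_small (e : R) : 0 < e -> exists2 z, lattice z & 0 < z.2 < e.
Proof.
move=> e0; have s1 : 1 < sqrt2.
  by rewrite -sqrtr1 ltr_sqrt ?ltr1n.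
have s2 : sqrt2 < 2.
  have -> : 2 = Num.sqrt 4 :> R by rewrite (_ : 4 = 2 ^+ 2) ?sqrtr_sqr ?ger0_norm//; ring.
  by rewrite ltr_sqrt// ltr_nat.
have lat k : exists2 z, lattice z & z.2 = (sqrt2 - 1) ^+ k.
  elim: k => [|k [_ [n [m ->]] /= IHk]].
    by exists (0%:~R, 0%:~R * sqrt2 + 1%:~R); [exists 0, 1|rewrite /= mul0r add0r].
  exists ((m - n)%:~R, (m - n)%:~R * sqrt2 + (2 * n - m)%:~R).
    by exists (m - n), (2 * n - m).
  rewrite exprS -IHk /= !rmorphB rmorphM /=.
  have ss : sqrt2 * sqrt2 = 2 by rewrite -expr2 sqr_sqrtr.
  have -> : (sqrt2 - 1) * (n%:~R * sqrt2 + m%:~R) =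
    n%:~R * (sqrt2 * sqrt2) + m%:~R * sqrt2 - n%:~R * sqrt2 - m%:~R by ring.
  by rewrite ss; ring.
have : (fun k => (sqrt2 - 1) ^+ k : R) @ \oo --> 0.
  by rewrite exprn_geometric; apply: cvg_geometric; rewrite ger0_norm; lra.
move=> /cvgrPdist_lt /(_ e e0) [k _ /(_ k (leqnn k))].
rewrite sub0r normrN ger0_norm ?exprn_ge0 ?subr_ge0 ?ltW// => ke.
have [z lz zE] := lat k; exists z => //; rewrite zE ke exprn_gt0//; lra.
Qed.

Lemma lattice_multiple z (k m : int) : lattice z ->
  lattice (z.1 * k%:~R, z.2 * k%:~R + m%:~R).
Proof.
move=> [n [m' ->]] /=; exists (n * k), (m' * k + m).
by rewrite rmorphD !rmorphM /=; congr (_, _); ring.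
Qed.

(** Kronecker density, with the direction of travel prescribed, so that half-lines
    of the foliation are dense too. A small lattice vector is repeated more than
    [N] times, after correcting the target by an integer. *)
Lemma lattice_dense (v e N : R) : 0 < e ->
  exists z, [/\ lattice z, `|z.2 - v| < e & N < z.1].
Proof.
move=> e0; have [z lz /andP[z0 ze]] : exists2 z, lattice z & 0 < z.2 < Num.min e 1.
  by apply: lattice_small; rewrite lt_min e0 ltr01.
move: ze; rewrite lt_min => /andP[ze z1].
have step (u K : R) : exists k m : int,
    [/\ K < k%:~R & 0 <= u - (z.2 * k%:~R + m%:~R) < e].
  pose m := Num.floor (u - z.2 * (K + 1)); pose k := Num.floor ((u - m%:~R) / z.2).
  have km : k%:~R <= (u - m%:~R) / z.2 by exact: floor_le_tmp.
  have mk : (u - m%:~R) / z.2 < k%:~R + 1 by rewrite -intrD1 floorD1_gt.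
  have mK : K + 1 <= (u - m%:~R) / z.2.
    rewrite ler_pdivlMr// mulrC lerBrDl -lerBrDr; exact: floor_le_tmp.
  exists k, m; split; first lra.
  rewrite ler_pdivlMr// in km; rewrite ltr_pdivrMr// in mk.
  have -> : z.2 * k%:~R = k%:~R * z.2 by rewrite mulrC.
  by rewrite mulrDl mul1r in mk; lra.
have [n [m' zE]] := lz.
have n0 : n != 0.
  apply/eqP => n0; move: z0 z1; rewrite zE n0 /= mul0r add0r ltr0z ltrz1.
  by move=> m0; rewrite ltNge -gtz0_ge1 m0.
have [npos|nneg] := ltP 0 n.
  have [k [m [Kk ukm]]] := step v `|N|.
  exists (z.1 * k%:~R, z.2 * k%:~R + m%:~R); split.
  - exact: lattice_multiple.
  - by rewrite /= ltr_norml; lra.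
  - rewrite zE /= (le_lt_trans (ler_norm N))// (lt_le_trans Kk)//.
    by rewrite ler_peMl ?ler1z -?gtz0_ge1// (le_trans _ (ltW Kk)).
have [k [m [Kk ukm]]] := step (- v) `|N|.
exists (- (z.1 * k%:~R, z.2 * k%:~R + m%:~R)); split.
- exact/latticeN/lattice_multiple.
- by rewrite /= ltr_norml; lra.
- rewrite zE /= -mulNr (le_lt_trans (ler_norm N))// (lt_le_trans Kk)//.
  rewrite ler_peMl ?(le_trans _ (ltW Kk))// -rmorphN/= ler1z -gtz0_ge1 oppr_gt0.
  by rewrite lt_neqAle n0.
Qed.

End lattice.

(** * The torus with a puncture opened into a long ray *)

Section reduction.
Variable R : realType.
Implicit Types (z w : R * R) (a b c d : closed_long_ray R).

(** The representative of a lattice coset in the unit square. *)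
Definition reduce z : R * R :=
  let y := z.2 - (Num.floor z.1)%:~R * sqrt2 R in
  (z.1 - (Num.floor z.1)%:~R, y - (Num.floor y)%:~R).

Lemma reduce_lattice z : lattice (z - reduce z).
Proof.
exists (Num.floor z.1), (Num.floor (z.2 - (Num.floor z.1)%:~R * sqrt2 R)).
by case: z => x y; rewrite /reduce /=; congr (_, _) => /=; ring.
Qed.

Lemma frac_part (x : R) : 0 <= x - (Num.floor x)%:~R < 1.
Proof. by rewrite subr_ge0 floor_le_tmp /= ltrBlDl -intrD1 floorD1_gt. Qed.

Lemma reduce_eq z w : lattice (z - w) -> reduce z = reduce w.
Proof.
move=> zw; apply/eqP; rewrite -subr_eq0; apply/eqP.
have lr : lattice (reduce z - reduce w).
  have -> : reduce z - reduce w =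
      (z - w) + (w - reduce w) - (z - reduce z).
    by rewrite addrA subrK opprB [RHS]addrC addrA subrK.
  by apply/latticeB/reduce_lattice/latticeD/reduce_lattice.
apply: lattice_discrete => //=; rewrite ltr_norml.
  by have := frac_part z.1; have := frac_part w.1; lra.
have := frac_part (z.2 - (Num.floor z.1)%:~R * sqrt2 R).
by have := frac_part (w.2 - (Num.floor w.1)%:~R * sqrt2 R); lra.
Qed.

(** Torus points are encoded by their reduced representatives, the lattice point
    being removed. Only the points of the long ray beyond its first unit segment
    are new: that segment is the half-leaf [x < 0], already present. *)
Definition proper_point (p : (R * R) + (omega1 * ico01 R)) : bool :=
  match p with
  | inl z => (reduce z == z) && (z != 0)
  | inr c => c.1 != omega1_0
  end.

Definition surf : Type := {p | proper_point p}.

HB.instance Definition _ := [isSub of surf for @sval _ _].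
HB.instance Definition _ := [Choice of surf by <:].

Lemma reduceK z : reduce (reduce z) = reduce z.
Proof. exact/reduce_eq/latticeBC/reduce_lattice. Qed.

Lemma reduce_eq0 z : lattice z <-> reduce z = 0.
Proof.
have r0 : reduce (0 : R * R) = 0.
  by rewrite /reduce /= floor0 mul0r !subr0 floor0 subr0.
split => [lz|rz]; first by rewrite -r0; apply: reduce_eq; rewrite subr0.
by have := reduce_lattice z; rewrite rz subr0.
Qed.

Lemma half_not_lattice : ~ lattice (2^-1 : R, 0 : R).
Proof. by move=> /lattice_horizontal /(_ erefl) /(congr1 fst) /= /eqP; rewrite invr_eq0 pnatr_eq0. Qed.

Lemma surf_point_subproof : proper_point (inl (reduce (2^-1, 0))).
Proof.
rewrite /= reduceK eqxx /=; apply/eqP => /reduce_eq0; exact: half_not_lattice.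
Qed.

Definition surf_point : surf := exist proper_point _ surf_point_subproof.

Definition flat z : surf := insubd surf_point (inl (reduce z)).

(** The long leaf, its first unit segment being the half-leaf [x < 0]. *)
Definition long (c : closed_long_ray R) : surf :=
  if c.1 == omega1_0 then flat (1 - (val c.2)^-1, 0)
  else insubd surf_point (inr c).

Lemma val_flat z : ~ lattice z -> val (flat z) = inl (reduce z).
Proof.
move=> nz; apply: insubdK; rewrite unfold_in /= reduceK eqxx /=.
by apply/eqP => /reduce_eq0.
Qed.

Lemma val_long c : c.1 != omega1_0 -> val (long c) = inr c.
Proof. by move=> c1; rewrite /long (negPf c1); apply: insubdK. Qed.

Lemma flat_eq z w : lattice (z - w) -> flat z = flat w.
Proof. by move=> zw; rewrite /flat (reduce_eq zw). Qed.

Lemma flat_inj z w : ~ lattice z -> ~ lattice w -> flat z = flat w ->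
  lattice (z - w).
Proof.
move=> nz nw /(congr1 val); rewrite !val_flat//.
move=> /(congr1 (fun p => if p is inl q then q else 0)) rzw.
have -> : z - w = (z - reduce z) - (w - reduce w).
  by rewrite rzw opprB addrA subrK.
by apply/latticeB/reduce_lattice; exact: reduce_lattice.
Qed.

Lemma axis_not_lattice (x : R) : x != 0 -> ~ lattice (x, 0).
Proof. by move=> x0 /lattice_horizontal /(_ erefl) [] /eqP; exact/negP. Qed.

Lemma long_axis_neg (c : closed_long_ray R) :
  c.1 = omega1_0 -> (long0 R < c)%O -> 1 - (val c.2)^-1 < 0.
Proof.
move=> c1 c0; rewrite subr_lt0 invf_gt1; first exact: ico_lt1.
exact: long0_lt c0 c1.
Qed.

Lemma long_flat c : c.1 = omega1_0 -> long c = flat (1 - (val c.2)^-1, 0).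
Proof. by move=> c1; rewrite /long c1 eqxx. Qed.

Lemma flat_neq_long z c : c.1 != omega1_0 -> flat z <> long c.
Proof.
move=> c1 /(congr1 val); rewrite val_long// /flat val_insubd.
by case: ifP.
Qed.

Lemma long_inj c d : (long0 R < c)%O -> (long0 R < d)%O -> long c = long d -> c = d.
Proof.
move=> c0 d0; have [c1|c1] := eqVneq c.1 omega1_0; last first.
  have [d1|d1] := eqVneq d.1 omega1_0.
    by rewrite (long_flat d1) => /esym /flat_neq_long [].
  by move=> /(congr1 val); rewrite !val_long// => -[].
have ncx : ~ lattice (1 - (val c.2)^-1, 0).
  by apply: axis_not_lattice; rewrite lt_eqF// long_axis_neg.
have [d1|d1] := eqVneq d.1 omega1_0; last first.
  by rewrite (long_flat c1) => /flat_neq_long [].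
rewrite !long_flat// => /flat_inj [] //.
  by apply: axis_not_lattice; rewrite lt_eqF// long_axis_neg.
move=> n [m mE]; have : lattice (1 - (val c.2)^-1 - (1 - (val d.2)^-1), 0 - 0 : R).
  by exists n, m.
rewrite subrr => /lattice_horizontal /(_ erefl) [].
move=> e; have {e}/invr_inj/val_inj cd : (val c.2)^-1 = (val d.2)^-1 by lra.
by move: c1 cd; case: (c) (d) d1 => [? ?] [? ?] /= -> -> ->.
Qed.

Lemma surf_cases (p : surf) : (exists2 z, ~ lattice z & p = flat z) \/
  exists2 c, c.1 != omega1_0 & p = long c.
Proof.
case: p => -[z|c] pp; [left; exists z|right; exists c] => //=.
- by move: pp => /= /andP[/eqP rz /eqP z0] /reduce_eq0; rewrite rz.
- apply: val_inj; rewrite val_flat /=.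
    by move: pp => /= /andP[/eqP ->].
  by move: pp => /= /andP[/eqP rz /eqP z0] /reduce_eq0; rewrite rz.
- by apply: val_inj; rewrite val_long.
Qed.

(** What [V] has to contain to be a neighbourhood of the points of the long ray
    between [a] and [b]. *)
Definition sandwich (a b : closed_long_ray R) (V : set surf) : Prop :=
  (forall c, (a < c < b)%O -> V (long c)) /\
  \forall y \near (0 : R)^', forall x, curve a y < x < curve b y -> V (flat (x, y)).

(** Curves are separated near the axis because their limiting coordinates are. *)
Lemma curve_lt a b : (long0 R < a)%O -> (a < b)%O ->
  \forall y \near (0 : R)^', curve a y < curve b y.
Proof.
move=> a0 ab; have b0 := lt_trans a0 ab.
have [h hP] := omega1_enum b.1.
have ab1 : (a.1 <= b.1)%O by have /long_ltP[/ltW|[->]] := ab.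
have cab := coord_lt hP ab1 ab.
pose m := (coord h a + coord h b) / 2.
near=> y; rewrite ltNge; apply/negP => ba.
have y0 : y != 0 by near: y; exact: nbhs_dnbhs_neq.
have sa : plane_coord h (curve a y, y) < m.
  by near: y; apply: (cvgr_lt _ (plane_coord_curve (h := h) a0)); rewrite /m; lra.
have sb : m < plane_coord h (curve b y, y).
  by near: y; apply: (cvgr_gt _ (plane_coord_curve (h := h) b0)); rewrite /m; lra.
have := lt_trans sa sb; rewrite ltNge => /negP; apply.
move: ba; rewrite le_eqVlt => /predU1P[->//|ba].
by apply: ltW; apply: (plane_coord_lt hP) => //; exact: curve_lt0.
Unshelve. all: by end_near. Qed.

Definition surf_open (V : set surf) : Prop :=
  (forall z, ~ lattice z -> V (flat z) -> \forall w \near z, V (flat w)) /\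
  forall c, c.1 != omega1_0 -> V (long c) ->
    exists a b, [/\ (long0 R < a)%O, (a < c < b)%O & sandwich a b V].

Lemma long_between_ex c : c.1 != omega1_0 ->
  exists a b, (long0 R < a)%O /\ (a < c < b)%O.
Proof.
move=> c1; exists (mk_long omega1_0 2^-1), (mk_long c.1 ((1 + val c.2) / 2)).
have := ico_ge0 c; have := ico_lt1 c => c_lt1 c_ge0.
split; first by apply/long_ltP; right; split=> //; rewrite mk_longK /=; lra.
apply/andP; split; apply/long_ltP; last by right; split=> //; rewrite mk_longK; lra.
by left; rewrite /= lt_neqAle omega1_0_le eq_sym c1.
Qed.

Lemma surf_openT : surf_open setT.
Proof.
split => [z _ _|c c1 _]; first exact: filterT.
have [a [b [a0 acb]]] := long_between_ex c1.
by exists a, b; split => //; split => //; exact: nearW.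
Qed.

Lemma surf_openI : setI_closed surf_open.
Proof.
move=> U V [fU lU] [fV lV]; split => [z nz [Uz Vz]|c c1 [Uc Vc]].
  by apply: filterI; [exact: fU|exact: fV].
have [a [b [a0 /andP[ac cb] [UL UF]]]] := lU _ c1 Uc.
have [a' [b' [a'0 /andP[a'c cb'] [VL VF]]]] := lV _ c1 Vc.
have le_curve d d' : (long0 R < d)%O -> (d <= d')%O ->
    \forall y \near (0 : R)^', curve d y <= curve d' y.
  move=> d0; rewrite le_eqVlt => /predU1P[->|dd'].
    by near=> y; exact: lexx.
  by apply: filterS (curve_lt d0 dd') => y /ltW.
have b0 : (long0 R < b)%O by exact/(lt_trans a0)/(lt_trans ac).
have b'0 : (long0 R < b')%O by exact/(lt_trans a'0)/(lt_trans a'c).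
have m0 : (long0 R < Order.min b b')%O by rewrite lt_min b0.
have lm1 : (Order.min b b' <= b)%O by rewrite ge_min lexx.
have lm2 : (Order.min b b' <= b')%O by rewrite ge_min lexx orbT.
have M1 : (a <= Order.max a a')%O by rewrite le_max lexx.
have M2 : (a' <= Order.max a a')%O by rewrite le_max lexx orbT.
exists (Order.max a a'), (Order.min b b'); split.
- by rewrite lt_max a0.
- by rewrite gt_max lt_min ac a'c cb cb'.
split=> [d /andP[ad db]|].
  split; [apply: UL|apply: VL]; apply/andP; split.
  + exact: le_lt_trans ad.
  + exact: lt_le_trans lm1.
  + exact: le_lt_trans ad.
  + exact: lt_le_trans lm2.
near=> y => x /andP[ax xb]; split.
  have FU : forall x, curve a y < x < curve b y -> U (flat (x, y)) by near: y.
  apply: FU; apply/andP; split.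
  + by apply: le_lt_trans ax; near: y; exact: le_curve.
  + by apply: (lt_le_trans xb); near: y; exact: le_curve.
have FV : forall x, curve a' y < x < curve b' y -> V (flat (x, y)) by near: y.
apply: FV; apply/andP; split.
+ by apply: le_lt_trans ax; near: y; exact: le_curve.
+ by apply: (lt_le_trans xb); near: y; exact: le_curve.
Unshelve. all: by end_near. Qed.

Lemma surf_open_bigcup (I : Type) (V : I -> set surf) :
  (forall i, surf_open (V i)) -> surf_open (\bigcup_i V i).
Proof.
move=> Vo; split => [z nz [i _ Vz]|c c1 [i _ Vc]].
  by have [+ _] := Vo i => /(_ _ nz Vz); apply: filterS => w Vw; exists i.
have [_ /(_ _ c1 Vc) [a [b [a0 acb [VL VF]]]]] := Vo i.
exists a, b; split => //; split => [d /VL ?|]; first by exists i.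
by apply: filterS VF => y Vy x /Vy ?; exists i.
Qed.

HB.instance Definition _ :=
  isOpenTopological.Build surf surf_openT surf_openI surf_open_bigcup.

Lemma surf_openE (V : set surf) : open V = surf_open V.
Proof. by []. Qed.

End reduction.

Arguments flat {R} z.
Arguments long {R} c.

(** * Coordinates around an initial piece of the long ray *)

Section collar.
Variable R : realType.
Implicit Types (z w q : R * R) (a c d : closed_long_ray R).
Variables (h : nat -> omega1) (b : omega1).
Hypothesis hP : range h = [set a | (a <= b)%O].

(** Continuity of [coord] at [c]. The upper point can be kept in the segment of
    [c], and the lower one beyond a prescribed [a0]. *)
Lemma coord_between a0 c (e : R) : (a0 < c)%O -> (c.1 <= b)%O -> 0 < e ->
  exists a d, [/\ (a0 < a < c)%O, (c < d)%O, d.1 = c.1,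
    coord h c - e < coord h a & coord h d < coord h c + e].
Proof.
move=> a0c cb e0; have a0b : (a0.1 <= b)%O.
  by have /long_ltP[/ltW/le_trans|[->//]] := a0c; apply.
have ca0 := coord_lt hP a0b a0c; have c1 := coord_lt1 hP cb.
have a0_ge0 := coord_ge0 h a0.
pose m := Num.max (coord h c - e) (coord h a0).
have m1 : coord h c - e <= m by rewrite le_max lexx.
have m2 : coord h a0 <= m by rewrite le_max lexx orbT.
have mc : m < coord h c by rewrite gt_max ca0 andbT; lra.
have [|a ab aE] := coord_surj hP (v := (m + coord h c) / 2); first lra.
pose M := Num.min (coord h c + e) 1.
have M1 : M <= coord h c + e by rewrite ge_min lexx.
have M2 : M <= 1 by rewrite ge_min lexx orbT.
have cM : coord h c < M by rewrite lt_min c1 andbT; lra.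
have [|d db dE] := coord_surj hP (v := (coord h c + M) / 2); first lra.
have lt_of_coord c' d' : coord h c' < coord h d' -> (c' < d')%O.
  by move=> cd'; rewrite ltNge; apply: contraTN cd' => /coord_le; rewrite -leNgt; apply.
have cd : (c < d)%O by apply: lt_of_coord; lra.
have ac : (a < c)%O by apply: lt_of_coord; lra.
have a0a : (a0 < a)%O by apply: lt_of_coord; lra.
have c_ge0 := ico_ge0 c; have c_lt1 := ico_lt1 c.
pose d' := mk_long c.1 ((1 + val c.2) / 2).
have cd' : (c < d')%O.
  by apply/long_ltP; right; split => //; rewrite mk_longK; lra.
have [dc|cd1] : d.1 = c.1 \/ (c.1 < d.1)%O.
  by have /long_ltP[|[]] := cd; [right|left].
- by exists a, d; split => //; [rewrite a0a ac|lra|lra].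
- exists a, d'; split => //; [by rewrite a0a ac|lra|].
  have : coord h d' <= coord h d by apply/coord_le/ltW/long_ltP; left.
  by lra.
Qed.

Lemma plane_coord_ivt (x0 x1 y v : R) : x1 < 0 ->
  plane_coord h (x0, y) < v < plane_coord h (x1, y) -> x0 < 0 ->
  exists2 x, x0 < x < x1 & plane_coord h (x, y) = v.
Proof.
move=> x10 /andP[v0 v1] x00.
have x01 : x0 < x1.
  rewrite ltNge; apply/negP; rewrite le_eqVlt => /predU1P[x01|x10'].
    by have := lt_trans v0 v1; rewrite x01 ltxx.
  by have := plane_coord_lt hP y x10' x00; lra.
have slice : {within `[x0, x1], continuous (fun x => plane_coord h (x, y))}.
  apply: continuous_in_subspaceT => x; rewrite inE /= in_itv /= => /andP[_ xx1].
  apply: (@continuous_cvg _ _ _ _ _ (fun x : R => (x, y)) (plane_coord h)).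
    by apply: plane_coord_continuous; exact: le_lt_trans x10.
  by apply: (@cvg_pair _ _ _ (nbhs x) (nbhs x) (nbhs y)); [exact: cvg_id|exact: cvg_cst].
have [|x] := IVT (v := v) (ltW x01) slice.
  by rewrite ge_min le_max (ltW v0) (ltW v1) orbT.
rewrite in_itv /= => /andP[x0x xx1] xv; exists x => //.
rewrite !lt_neqAle x0x xx1 !andbT; apply/andP; split; apply/eqP => xE.
  by move: v0; rewrite xE xv ltxx.
by move: v1; rewrite -xE xv ltxx.
Qed.

(** Small enough to inject into the torus. *)
Definition window : set (R * R) :=
  [set q | (- 4^-1 < q.1 < 0) && (- 4^-1 < q.2 < 4^-1)].

Definition collar : set (surf R) :=
  [set p | exists c, [/\ c.1 != omega1_0, (c.1 <= b)%O & p = long c]] `|`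
  flat @` window.

(** A torus point of the collar has its coordinates read off at its representative
    in the window, which is unique. *)
Definition collar_map (p : surf R) : R * R :=
  match val p with
  | inl z => let q := xget 0 [set q | window q /\ lattice (z - q)] in
             (plane_coord h q, q.2)
  | inr c => (coord h c, 0)
  end.

Lemma window_not_lattice q : window q -> ~ lattice q.
Proof.
move=> /andP[q1 q2] /lattice_discrete q0.
have : q = 0 by apply: q0; rewrite ltr_norml; lra.
by move=> q_eq0; move: q1; rewrite q_eq0 /=; lra.
Qed.

Lemma window_inj q w : window q -> window w -> lattice (q - w) -> q = w.
Proof.
move=> /andP[q1 q2] /andP[w1 w2] /lattice_discrete qw.
by apply/eqP; rewrite -subr_eq0; apply/eqP/qw; rewrite ltr_norml /=; lra.
Qed.

Lemma window_open : open window.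
Proof.
rewrite openE => q /andP[q1 q2]; apply: filterS2.
- by move=> w w1 w2; apply/andP; split; [exact: w1|exact: w2].
- apply: (@near_fst _ _ q (fun x => - 4^-1 < x < 0)).
  by apply: near_in_itvoo; rewrite in_itv.
- apply: (@near_snd _ _ q (fun x => - 4^-1 < x < 4^-1)).
  by apply: near_in_itvoo; rewrite in_itv.
Qed.

Lemma collar_map_flat q : window q -> collar_map (flat q) = (plane_coord h q, q.2).
Proof.
move=> wq; have nq := window_not_lattice wq.
rewrite /collar_map val_flat//; case: xgetP => [q' _ [wq' lq']|/(_ q)].
  suff -> : q = q' by [].
  apply: window_inj => //; have := latticeD (reduce_lattice q) lq'.
  by rewrite addrA subrK.
by move=> []; split => //; exact/latticeBC/reduce_lattice.
Qed.

Lemma collar_map_long c : c.1 != omega1_0 -> collar_map (long c) = (coord h c, 0).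
Proof. by move=> c1; rewrite /collar_map val_long. Qed.

Lemma axis_long (x : R) : x < 0 -> exists c, [/\ c.1 = omega1_0,
  (long0 R < c)%O, x = 1 - (val c.2)^-1 & long c = flat (x, 0)].
Proof.
move=> x0; have t0 : 0 < (1 - x)^-1 by rewrite invr_gt0; lra.
have t1 : (1 - x)^-1 < 1 by rewrite invf_lt1; lra.
have c2 : val (mk_long omega1_0 (1 - x)^-1).2 = (1 - x)^-1.
  by rewrite mk_longK// t1 ltW.
exists (mk_long omega1_0 (1 - x)^-1); split => //.
- by apply/long_ltP; right; split => //; rewrite c2.
- by rewrite c2 invrK; lra.
- by rewrite long_flat// c2 invrK subKr.
Qed.

(** The two cases are told apart by the height in the window. *)
Lemma collar_cases p : collar p ->
  (exists q, [/\ window q, q.2 != 0 & p = flat q]) \/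
  exists c, [/\ (long0 R < c)%O, (c.1 <= b)%O, p = long c
    & collar_map p = (coord h c, 0)].
Proof.
move=> [[c [c1 cb ->]]|[q wq <-]].
  right; exists c; split => //; last exact: collar_map_long.
  by apply/long_ltP; left; rewrite lt_neqAle eq_sym c1 omega1_0_le.
have [q2|q2] := eqVneq q.2 0; last by left; exists q.
right; have q0 : q.1 < 0 by move: wq => /andP[/andP[]].
have [c [c1 c0 qc lc]] := axis_long q0.
have qE : q = (q.1, 0) by rewrite -q2; case: (q).
exists c; split => //; first by rewrite c1 omega1_0_le.
  by rewrite lc -qE.
rewrite collar_map_flat// q2 [in plane_coord h q]qE qc plane_coord_axis//.
exact: long0_lt c0 c1.
Qed.

Lemma collar_flat q : window q -> collar (flat q).
Proof. by move=> wq; right; exists q. Qed.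

Lemma collar_inj : {in collar &, injective collar_map}.
Proof.
move=> p p' /set_mem cp /set_mem cp'.
have [[q [wq q2 ->]]|[c [c0 cb -> ->]]] := collar_cases cp;
  have [[q' [wq' q2' ->]]|[c' [c0' cb' -> ->]]] := collar_cases cp'.
- rewrite !collar_map_flat// => -[sq qq']; congr flat.
  case: q q' wq wq' sq qq' {q2 q2'} => [x y] [x' y'] wq wq' /= + yy'.
  move: wq wq'; rewrite -{}yy' => /andP[/andP[_ x0] _] /andP[/andP[_ x0'] _].
  have [xx'|xx'|->//] := ltgtP x x'.
    by have := plane_coord_lt hP y xx' x0' => /[swap] ->; rewrite ltxx.
  by have := plane_coord_lt hP y xx' x0 => /[swap] ->; rewrite ltxx.
- by rewrite collar_map_flat// => -[_ /eqP]; rewrite (negPf q2).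
- by rewrite collar_map_flat// => -[_ /esym /eqP]; rewrite (negPf q2').
- move=> -[cc']; congr long; have [lt|lt|//] := ltgtP c c'.
    by have := coord_lt hP cb lt; rewrite cc' ltxx.
  by have := coord_lt hP cb' lt; rewrite cc' ltxx.
Qed.

Lemma translate_near z q (P : set (R * R)) :
  (\forall w \near q, P w) -> \forall w \near z, P (w - (z - q)).
Proof.
move=> qP; have : (w - (z - q)) @[w --> z] --> q.
  have -> : nbhs q = nbhs (z - (z - q)) by rewrite subKr.
  by apply: cvgB; [exact: cvg_id|exact: cvg_cst].
by apply.
Qed.

(** The curve of this point is the vertical line [x = - 1 / 8]. *)
Definition near_puncture : closed_long_ray R := mk_long omega1_0 (8 / 9).

Lemma near_punctureE : val near_puncture.2 = 8 / 9.
Proof. by rewrite mk_longK; lra. Qed.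

Lemma near_puncture_gt0 : (long0 R < near_puncture)%O.
Proof. by apply/long_ltP; right; split => //; rewrite near_punctureE /=; lra. Qed.

Lemma near_puncture_lt c : c.1 != omega1_0 -> (near_puncture < c)%O.
Proof.
by move=> c1; apply/long_ltP; left; rewrite /= lt_neqAle eq_sym c1 omega1_0_le.
Qed.

Lemma curve_near_puncture (y : R) : curve near_puncture y = - 8^-1.
Proof. by rewrite curve0// near_punctureE; lra. Qed.

(** The points of the first segment beyond [near_puncture] have their
    representatives in the window. *)
Lemma collar_long c : (near_puncture < c)%O -> (c.1 <= b)%O ->
  collar (long c) /\ collar_map (long c) = (coord h c, 0).
Proof.
move=> pc cb; have c0 := lt_trans near_puncture_gt0 pc.
have [c1|c1] := eqVneq c.1 omega1_0; last first.
  by split; [left; exists c|exact: collar_map_long].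
have ws : window (1 - (val c.2)^-1, 0).
  have : val near_puncture.2 < val c.2.
    have /long_ltP := pc.
    by rewrite c1 /= ltNge omega1_0_le /= => -[//|[]].
  rewrite near_punctureE => c2.
  apply/andP; split => /=; last by lra.
  rewrite long_axis_neg// andbT.
  have : (val c.2)^-1 < (4 / 5)^-1 by rewrite ltf_pV2 ?posrE; lra.
  by rewrite invf_div; lra.
rewrite long_flat//; split; first exact: collar_flat.
by rewrite collar_map_flat// plane_coord_axis//; exact: long0_lt c0 c1.
Qed.

(** Continuity of [collar_map]. At a new point it follows by squeezing between two
    curves, whose plane coordinates converge to prescribed long coordinates. *)
Lemma collar_open (W : set (R * R)) : open W ->
  open (collar `&` collar_map @^-1` W).
Proof.
move=> Wo; rewrite surf_openE; split => [z nz [cz Wz]|c c1 [cc Wc]].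
  case: cz => [[c [c1 _ /flat_neq_long]]|[q wq /esym qz]]; first by case.
  have lzq := flat_inj nz (window_not_lattice wq) qz.
  have flatB w : flat w = flat (w - (z - q)).
    by apply: flat_eq; rewrite subKr.
  suff : \forall w \near q, window w /\ W (plane_coord h w, w.2).
    move=> /(@translate_near z); apply: filterS => w [ww Ww]; split.
      by rewrite flatB; exact: collar_flat.
    by rewrite /= flatB collar_map_flat.
  have q0 : q.1 < 0 by move: wq => /andP[/andP[]].
  apply: filterI; first exact: (open_nbhs_nbhs (conj window_open wq)).
  have : (plane_coord h w, w.2) @[w --> q] --> (plane_coord h q, q.2).
    apply: (@cvg_pair _ _ _ (nbhs q) (nbhs (plane_coord h q)) (nbhs q.2)).
      exact: plane_coord_continuous.
    exact: cvg_snd.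
  apply; apply: open_nbhs_nbhs; split => //.
  by move: Wz; rewrite qz /= collar_map_flat.
have cb : (c.1 <= b)%O.
  case: cc => [[c' [c1' cb lc]]|[q wq /flat_neq_long]]; last by case.
  by rewrite (long_inj _ _ lc)//; apply/long_ltP; left;
     rewrite lt_neqAle eq_sym ?c1 ?c1' omega1_0_le.
move: Wc; rewrite /= collar_map_long// => Wc.
have [[U1 U2] [/nbhs_ballP[e1 e10 eU1] /nbhs_ballP[e2 e20 eU2]] UW] :
    nbhs (coord h c, 0 : R) W by exact: open_nbhs_nbhs.
pose e := Num.min e1 e2; have e0 : 0 < e by rewrite lt_min e10.
have eW x y : `|x - coord h c| < e -> `|y| < e -> W (x, y).
  move=> xe ye; apply: UW; split => /=.
    by apply: eU1; rewrite /ball /= distrC (lt_le_trans xe)// ge_min lexx.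
  by apply: eU2; rewrite /ball /= sub0r normrN (lt_le_trans ye)// ge_min lexx orbT.
have [a [d [/andP[a0a ac] cd d1 ca dc]]] :=
  coord_between (near_puncture_lt c1) cb e0.
have a0 := lt_trans near_puncture_gt0 a0a.
have d0 := lt_trans a0 (lt_trans ac cd).
exists a, d; split => //; first by rewrite ac cd.
split=> [s /andP[as_ sd]|].
  have sb : (s.1 <= b)%O.
    by apply: le_trans cb; rewrite -d1; have /long_ltP[/ltW|[->]] := sd.
  have We : W (coord h s, 0).
    apply: eW; last by rewrite normr0.
    have := coord_le h (ltW as_); have := coord_le h (ltW sd).
    by rewrite ltr_norml; lra.
  have [cs csE] := collar_long (lt_trans a0a as_) sb.
  by split => //; rewrite /= csE.
have sa := plane_coord_curve (h := h) a0; have sd := plane_coord_curve (h := h) d0.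
near=> y => x /andP[ax xd].
have y0 : y != 0 by near: y; exact: nbhs_dnbhs_neq.
have ye : `|y| < e by near: y; exact: dnbhs0_lt.
have y4 : `|y| < 4^-1 by near: y; apply: dnbhs0_lt; lra.
have d_lt0 := curve_lt0 d0 y0.
have a_ge : curve near_puncture y < curve a y.
  by near: y; exact: curve_lt near_puncture_gt0 a0a.
have wxy : window (x, y).
  move: a_ge y4; rewrite curve_near_puncture ltr_norml => a_ge y4.
  by apply/andP; split => //=; lra.
split; first exact: collar_flat.
rewrite /= collar_map_flat//; apply: eW => //.
have s1 : coord h c - e < plane_coord h (curve a y, y).
  by near: y; exact: (cvgr_gt _ sa).
have s2 : plane_coord h (curve d y, y) < coord h c + e.
  by near: y; exact: (cvgr_lt _ sd).
have s3 : plane_coord h (curve a y, y) < plane_coord h (x, y).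
  by apply: (plane_coord_lt hP) => //; lra.
have s4 : plane_coord h (x, y) < plane_coord h (curve d y, y).
  exact: (plane_coord_lt hP).
by rewrite ltr_norml; lra.
Unshelve. all: by end_near. Qed.

Lemma coord_lt_cancel c d : coord h c < coord h d -> (c < d)%O.
Proof.
move=> cd; rewrite ltNge; apply: contraTN cd => /(coord_le h).
by rewrite -leNgt.
Qed.

(** Continuity of the inverse of [collar_map]. Since coordinates increase along
    leaves, a point whose coordinate is between those of two curves is itself
    between the two curves. *)
Lemma collar_open_map (V : set (surf R)) p : open V -> collar p -> V p ->
  \forall z \near collar_map p,
    forall p', collar p' -> collar_map p' = z -> V p'.
Proof.
move=> Vo cp Vp.
case: cp Vp => [[c [c1 cb ->]] Vc|[q wq <-] Vq].
  have [_ /(_ c c1 Vc) [a [d [a0 /andP[ac cd] [VL VF]]]]] := Vo.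
  have d0 := lt_trans a0 (lt_trans ac cd).
  have ab : (a.1 <= b)%O.
    by apply: le_trans cb; have /long_ltP[/ltW|[->]] := ac.
  have cac := coord_lt hP ab ac; have ccd := coord_lt hP cb cd.
  pose u := (coord h a + coord h c) / 2; pose v := (coord h c + coord h d) / 2.
  have au : coord h a < u by rewrite /u; lra.
  have vd : v < coord h d by rewrite /v; lra.
  rewrite collar_map_long//.
  have near_y : \forall y \near (0 : R), y != 0 ->
      [/\ forall x, curve a y < x < curve d y -> V (flat (x, y)),
          plane_coord h (curve a y, y) < u & v < plane_coord h (curve d y, y)].
    suff : \forall y \near (0 : R)^',
      [/\ forall x, curve a y < x < curve d y -> V (flat (x, y)),
          plane_coord h (curve a y, y) < u & v < plane_coord h (curve d y, y)] by [].
    have sa := plane_coord_curve (h := h) a0; have sd := plane_coord_curve (h := h) d0.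
    near=> y; split.
    + by near: y.
    + by near: y; exact: (cvgr_lt _ sa).
    + by near: y; exact: (cvgr_gt _ sd).
  near=> z => p' /collar_cases [[q [wq q2 ->]]|[s [s0 sb -> ->]]] pz; last first.
    apply: VL; apply/andP.
    have zac : z.1 \in `]coord h a, coord h d[.
      near: z; apply: (@near_fst _ _ (coord h c, 0 : R)
        (fun x => x \in `]coord h a, coord h d[)).
      by apply: near_in_itvoo; rewrite in_itv /= cac ccd.
    move: zac; rewrite -pz in_itv /= => /andP[as_ sd].
    by split; exact: coord_lt_cancel.
  rewrite collar_map_flat// in pz.
  have [Vx sa sd] : [/\ forall x, curve a z.2 < x < curve d z.2 -> V (flat (x, z.2)),
      plane_coord h (curve a z.2, z.2) < u & v < plane_coord h (curve d z.2, z.2)].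
    have z2 : z.2 != 0 by rewrite -pz.
    move: z2; near: z.
    exact: (@near_snd _ _ (coord h c, 0 : R) _ near_y).
  have zuv : z.1 \in `]u, v[.
    near: z; apply: (@near_fst _ _ (coord h c, 0 : R) (fun x => x \in `]u, v[)).
    by apply: near_in_itvoo; rewrite in_itv /= /u /v; lra.
  move: Vx sa sd zuv; rewrite -pz in_itv /= => Vx sa sd /andP[uq qv].
  have q0 : q.1 < 0 by move: wq => /andP[/andP[]].
  have qE : q = (q.1, q.2) by case: (q).
  rewrite qE; apply: Vx; apply/andP; split; rewrite ltNge; apply/negP.
    rewrite le_eqVlt => /predU1P[qa|qa].
      by have := lt_trans sa uq; rewrite -qa -qE ltxx.
    have := plane_coord_lt hP q.2 qa (curve_lt0 a0 q2); rewrite -qE; lra.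
  rewrite le_eqVlt => /predU1P[qd|qd].
    by have := lt_trans qv sd; rewrite qd -qE ltxx.
  have := plane_coord_lt hP q.2 qd q0; rewrite -qE; lra.
have nq := window_not_lattice wq.
have [/(_ q nq Vq) /nbhs_ballP[e /= e0 eV] _] := Vo.
have q0 : q.1 < 0 by move: wq => /andP[/andP[]].
pose r := Num.min (e / 2) (- q.1 / 2).
have r0 : 0 < r by rewrite lt_min; apply/andP; split; lra.
have re : r < e by rewrite gt_min; apply/orP; left; lra.
have rq : q.1 + r < 0.
  have : r <= - q.1 / 2 by rewrite ge_min lexx orbT.
  by lra.
have qE : q = (q.1, q.2) by case: (q).
have s1 : plane_coord h (q.1 - r, q.2) < plane_coord h q.
  by rewrite [X in _ < plane_coord h X]qE; apply: (plane_coord_lt hP) => //; lra.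
have s2 : plane_coord h q < plane_coord h (q.1 + r, q.2).
  by rewrite [X in plane_coord h X < _]qE; apply: (plane_coord_lt hP) => //; lra.
pose u := (plane_coord h (q.1 - r, q.2) + plane_coord h q) / 2.
pose v := (plane_coord h q + plane_coord h (q.1 + r, q.2)) / 2.
have slice x : x < 0 -> plane_coord h (x, y) @[y --> q.2] --> plane_coord h (x, q.2).
  move=> x0; apply: (@continuous_cvg _ _ _ _ _ (fun y : R => (x, y)) (plane_coord h)).
    exact: plane_coord_continuous.
  by apply: (@cvg_pair _ _ _ (nbhs q.2) (nbhs x) (nbhs q.2)); [exact: cvg_cst|exact: cvg_id].
have near_y : \forall y \near q.2, [/\ `|q.2 - y| < e,
    plane_coord h (q.1 - r, y) < u & v < plane_coord h (q.1 + r, y)].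
  have sr : q.1 - r < 0 by lra.
  have sl := slice _ sr; have sr' := slice _ rq.
  near=> y; split.
  + near: y; have /cvgrPdist_lt : y @[y --> q.2] --> q.2 by exact: cvg_id.
    exact.
  + by near: y; apply: (cvgr_lt _ sl); rewrite /u; lra.
  + by near: y; apply: (cvgr_gt _ sr'); rewrite /v; lra.
rewrite collar_map_flat//.
near=> z => p' cp' pz.
have [ze za zb] : [/\ `|q.2 - z.2| < e,
    plane_coord h (q.1 - r, z.2) < u & v < plane_coord h (q.1 + r, z.2)].
  by near: z; exact: (@near_snd _ _ (plane_coord h q, q.2) _ near_y).
have : z.1 \in `]u, v[.
  near: z; apply: (@near_fst _ _ (plane_coord h q, q.2) (fun x => x \in `]u, v[)).
  by apply: near_in_itvoo; rewrite in_itv /= /u /v; lra.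
rewrite in_itv /= => /andP[uz zv].
case: cp' pz => [[c [c1 cb ->]]|[w ww <-]].
  rewrite collar_map_long// => zE; rewrite -zE /= in ze za zb uz zv.
  have [d [d1 d0 dE _]] := axis_long rq.
  have dc : (d < c)%O by apply/long_ltP; left; rewrite d1 lt_neqAle eq_sym c1 omega1_0_le.
  have := coord_le h (ltW dc).
  by rewrite -plane_coord_axis// -?dE; [lra|exact: long0_lt d0 d1].
rewrite collar_map_flat// => zE; rewrite -zE /= in ze za zb uz zv.
have w0 : w.1 < 0 by move: ww => /andP[/andP[]].
have wE : w = (w.1, w.2) by case: (w).
apply: eV; split; rewrite /ball_ /= /ball //=.
suff : `|q.1 - w.1| < r by move=> /lt_trans; apply.
have wr : w.1 < q.1 + r.
  rewrite ltNge; apply/negP; rewrite le_eqVlt => /predU1P[qw|qw].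
    by have := lt_trans zv zb; rewrite qw -wE ltxx.
  by have := plane_coord_lt hP w.2 qw w0; rewrite -wE; lra.
have rw_ : q.1 - r < w.1.
  rewrite ltNge; apply/negP; rewrite le_eqVlt => /predU1P[qw|qw].
    by have := lt_trans za uz; rewrite -qw -wE ltxx.
  have qr0 : q.1 - r < 0 by lra.
  by have := plane_coord_lt hP w.2 qw qr0; rewrite -wE; lra.
by rewrite ltr_norml; lra.
Unshelve. all: by end_near. Qed.

End collar.

(** * Foliations and leaves from partial data *)

Section charts_of_maps.
Variables (R : realType) (M : topologicalType).
Implicit Types (c d e : chart R M) (p q : M).

(** A chart needs a total inverse; it is provided by choice, and continuity of
    that inverse is expressed without mentioning it. *)
Lemma chart_of (p0 : M) (D : set M) (B : set (R * R)) (phi : M -> R * R) :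
  open D -> open B -> (forall p, D p -> B (phi p)) -> {in D &, injective phi} ->
  (forall z, B z -> exists2 p, D p & phi p = z) ->
  (forall p, D p -> {for p, continuous phi}) ->
  (forall p V, open V -> D p -> V p ->
    \forall z \near phi p, forall q, D q -> phi q = z -> V q) ->
  exists c, [/\ chart_dom c = D, chart_cod c = B & chart_map c = phi].
Proof.
move=> Do Bo DB phi_inj phi_surj phi_cont phi_open.
have /choice[psi psiP] : forall z, exists p, B z -> D p /\ phi p = z.
  move=> z; have [/phi_surj[p Dp pz]|nBz] := pselect (B z); first by exists p.
  by exists p0.
have psiK p : D p -> psi (phi p) = p.
  move=> Dp; have [Dq qE] := psiP _ (DB _ Dp).
  by apply: phi_inj => //; exact/mem_set.
have phi_within : {within D, continuous phi}.
  rewrite continuous_open_subspace// => p /set_mem; exact: phi_cont.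
have psi_within : {within B, continuous psi}.
  rewrite continuous_open_subspace// => z /set_mem Bz.
  have [Dp pz] := psiP z Bz.
  move=> U /=; rewrite {1}nbhsE => -[V [Vo Vp] VU].
  have := phi_open _ _ Vo Dp Vp; rewrite pz.
  have : \forall w \near z, B w by exact: open_nbhs_nbhs.
  apply: filterS2 => w Bw Hw; apply: VU.
  by have [Dw wE] := psiP w Bw; exact: Hw.
unshelve eexists (@Chart R M D B phi psi Do Bo DB _ psiK _ phi_within psi_within) => //.
- by move=> z /psiP[].
- by move=> z /psiP[].
Qed.

Lemma chart_map_cvg c p : chart_dom c p -> {for p, continuous (chart_map c)}.
Proof.
move=> cp; have := @chart_map_continuous _ _ c.
by rewrite continuous_open_subspace ?inE; [apply; exact/mem_set|exact: chart_dom_open].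
Qed.

Lemma chart_inv_cvg c p : chart_dom c p ->
  chart_inv c w @[w --> chart_map c p] --> p.
Proof.
move=> cp; have := @chart_inv_continuous _ _ c.
rewrite continuous_open_subspace; last exact: chart_cod_open.
move=> /(_ (chart_map c p)); rewrite /continuous_at chart_mapK//; apply.
exact/mem_set/chart_map_cod.
Qed.

(** A coordinate change is foliated when locally its second coordinate is a
    function of the second coordinate alone, the first one being arbitrary. *)
Definition transverse c d : Prop := forall p, chart_dom c p -> chart_dom d p ->
  exists g : R -> R, \forall w \near chart_map c p,
    (chart_map d (chart_inv c w)).2 = g w.2.

Lemma foliated_changeE c d : foliated_change c d <-> transverse c d.
Proof.
split=> [cd p cp dp|cd z [p [cp dp] <-]].
  have [|f [g fg]] := cd (chart_map c p); first by exists p.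
  by exists g; apply: filterS fg => w; rewrite /coordinate_change /= => ->.
have [g gP] := cd p cp dp.
exists (fun x y => (coordinate_change c d (x, y)).1), g.
by apply: filterS gP => -[x y] /=; rewrite /coordinate_change/= => <-; case: (chart_map d _).
Qed.

(** Being foliated can be tested through an intermediate chart around each point;
    this is what makes the set of all charts compatible with an atlas an atlas. *)
Lemma transverse_trans c d :
  (forall p, chart_dom c p -> chart_dom d p -> exists e,
    [/\ chart_dom e p, transverse c e & transverse e d]) -> transverse c d.
Proof.
move=> H p cp dp; have [e [ep ce ed]] := H p cp dp.
have [g gP] := ce p cp ep; have [g' g'P] := ed p ep dp.
exists (g' \o g).
have inv_p := chart_inv_cvg cp.
have near_e : \forall w \near chart_map c p, chart_dom e (chart_inv c w).
  by apply: inv_p; exact: (open_nbhs_nbhs (conj (chart_dom_open e) ep)).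
have near_g' : \forall w \near chart_map c p,
    (chart_map d (chart_inv e (chart_map e (chart_inv c w)))).2 =
    g' (chart_map e (chart_inv c w)).2.
  exact: (inv_p _ (chart_map_cvg ep g'P)).
near=> w.
have ew : chart_dom e (chart_inv c w) by near: w.
rewrite -[chart_inv c w](chart_mapK ew) /=.
have -> : g w.2 = (chart_map e (chart_inv c w)).2 by apply/esym; near: w.
by near: w.
Unshelve. all: by end_near. Qed.

Lemma foliation_of_atlas (A : set (chart R M)) : foliated_atlas A ->
  exists2 F : foliation R M, A `<=` foliation_atlas F &
    forall c d, foliation_atlas F c -> A d -> transverse d c.
Proof.
move=> [Acov Abox Afol].
pose B : set (chart R M) := [set c | open_box (chart_cod c) /\
  forall d, A d -> transverse c d /\ transverse d c].
have AB : A `<=` B.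
  move=> c Ac; split; first exact: Abox.
  by move=> d Ad; split; apply/foliated_changeE; exact: Afol.
have BP : foliated_atlas B.
  split=> [p|c []//|c d [_ cA] [_ dA]].
    by have [c Ac cp] := Acov p; exists c => //; exact: AB.
  apply/foliated_changeE/transverse_trans => p cp dp.
  have [e Ae ep] := Acov p.
  by exists e; split => //; [have [] := cA e Ae|have [] := dA e Ae].
have Bmax A' : foliated_atlas A' -> B `<=` A' -> A' `<=` B.
  move=> [_ A'box A'fol] BA' c A'c; split; first exact: A'box.
  move=> d /AB /BA' A'd; split; apply/foliated_changeE; exact: A'fol.
exists (Foliation BP Bmax) => //= c d [_ cA] Ad.
by have [] := cA d Ad.
Qed.

End charts_of_maps.

Section leaf_topology.
Variables (R : realType) (M : topologicalType) (F : foliation R M).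

Lemma plaque_open c y (O : set M) : foliation_atlas F c -> open O ->
  open (plaque c y `&` O : set (leaf_space F)).
Proof.
move=> Fc Oo; set P := plaque c y `&` O.
exists [set P]; last by rewrite bigcup_set1.
move=> _ ->; apply: (@finI_from1 _ _ _ id).
by exists c, y, O.
Qed.

(** Continuity can be tested on the generating sets. *)
Lemma leaf_space_continuous (L : topologicalType) (f : L -> leaf_space F) :
  (forall c y O s, foliation_atlas F c -> open O ->
    (plaque c y `&` O) (f s) -> \forall t \near s, (plaque c y `&` O) (f t)) ->
  continuous f.
Proof.
move=> fP s U; rewrite {1}nbhsE => -[V [[D DF <-] [S DS Sfs]] VU].
suff : \forall t \near s, S (f t).
  by apply: filterS => t St; apply: VU; exists S.
have [E EF ES] := DF _ DS; rewrite -ES in Sfs *.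
suff : nbhs s (\bigcap_(i in [set` E]) (f @^-1` i)) by [].
apply: filter_bigI => i Ei.
have /asboolP [c [y [U' [Fc Uo iE]]]] := EF _ Ei.
have := Sfs _ Ei; rewrite /= {}iE => ifs.
exact: fP.
Qed.

Variable A : set (chart R M).
Hypothesis AF : A `<=` foliation_atlas F.
Hypothesis A_transverse :
  forall c d, foliation_atlas F c -> A d -> transverse d c.

(** A curve that is locally horizontal in the charts of an atlas stays inside
    the plaques of all foliated charts. *)
Lemma horizontal_continuous (L : topologicalType) (f : L -> M) :
  continuous f ->
  (forall s, exists c, [/\ A c, chart_dom c (f s) &
    \forall t \near s, (chart_map c (f t)).2 = (chart_map c (f s)).2]) ->
  continuous (f : L -> leaf_space F).
Proof.
move=> fc fh; apply: leaf_space_continuous => c y O s Fc Oo [[cs cy] Os].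
have [d [Ad ds hs]] := fh s.
have [g gP] := A_transverse Fc Ad ds cs.
have near_c : \forall t \near s, chart_dom c (f t).
  by apply: fc; exact: (open_nbhs_nbhs (conj (chart_dom_open c) cs)).
have near_d : \forall t \near s, chart_dom d (f t).
  by apply: fc; exact: (open_nbhs_nbhs (conj (chart_dom_open d) ds)).
have near_O : \forall t \near s, O (f t) by apply: fc; exact: open_nbhs_nbhs.
have near_g : \forall t \near s,
    (chart_map c (chart_inv d (chart_map d (f t)))).2 = g (chart_map d (f t)).2.
  exact: (fc _ _ (chart_map_cvg ds gP)).
near=> t.
have dt : chart_dom d (f t) by near: t.
have ct : (chart_map c (f t)).2 = g (chart_map d (f t)).2.
  by rewrite -[in LHS](chart_mapK dt); near: t.
split; last by near: t.
split; first by near: t.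
rewrite /= ct (_ : (chart_map d (f t)).2 = (chart_map d (f s)).2); last by near: t.
have /nbhs_singleton : \forall w \near chart_map d (f s),
    (chart_map c (chart_inv d w)).2 = g w.2 by [].
by rewrite chart_mapK// => <-.
Unshelve. all: by end_near. Qed.

Lemma plaquewise_open (L : topologicalType) (f : L -> M) :
  (forall s J, open J -> J s -> exists c y O, [/\ A c, open O,
     (plaque c y `&` O) (f s) & plaque c y `&` O `<=` f @` J]) ->
  forall J, open J -> open (f @` J : set (leaf_space F)).
Proof.
move=> fP J Jo; rewrite openE => _ [s Js <-].
have [c [y [U [Ac Uo cs sub]]]] := fP s J Jo Js.
apply: (@filterS (leaf_space F) (nbhs (f s : leaf_space F)) _ _ _ sub).
by apply: open_nbhs_nbhs; split => //; apply: plaque_open => //; exact: AF.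
Qed.

End leaf_topology.

Section embeddings.
Variables (L X : topologicalType) (f : L -> X).
Hypotheses (f_inj : injective f) (f_cont : continuous f).
Hypothesis f_open : forall J, open J -> open (f @` J).

Lemma homeomorphic_range : homeomorphic (range f) L.
Proof.
have /choice[g gP] : forall p : range f, exists s, f s = val p.
  by move=> [p pf] /=; have [s _ <-] := set_mem pf; exists s.
pose k s : range f := exist _ (f s) (mem_set (imageT f s)).
exists g, k; split.
- by move=> p; apply: val_inj; rewrite /= gP.
- by move=> s; apply: f_inj; rewrite gP.
- apply/continuousP => J Jo; exists (f @` J); first exact: f_open.
  apply/seteqP; split => p /=; last by move=> Jp; exists (g p) => //; rewrite gP.
  by move=> [s Js sp]; have <- : s = g p by apply: f_inj; rewrite gP.
- apply/continuousP => _ [U Uo <-].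
  have -> : k @^-1` (set_val @^-1` U) = f @^-1` U by [].
  by apply: open_comp => // s _; exact: f_cont.
Qed.

End embeddings.

Lemma homeomorphic_sym (X Y : topologicalType) : homeomorphic X Y -> homeomorphic Y X.
Proof. by move=> [f [g [fg gf cf cg]]]; exists g, f; split. Qed.

Lemma homeomorphic_trans (X Y Z : topologicalType) :
  homeomorphic X Y -> homeomorphic Y Z -> homeomorphic X Z.
Proof.
move=> [f [g [fg gf cf cg]]] [f' [g' [fg' gf' cf' cg']]].
exists (f' \o f), (g \o g'); split; [exact: can_comp|exact: can_comp|..].
  by move=> x; apply: continuous_comp; [exact: cf|exact: cf'].
by move=> x; apply: continuous_comp; [exact: cg'|exact: cg].
Qed.

(** Each of the sets is also closed, its complement being the union of the
    others. *)
Lemma component_of_open_cover (X : topologicalType) (P : set (set X)) (C : set X) x :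
  (forall B, P B -> open B /\ connected B) ->
  (forall B B', P B -> P B' -> B `&` B' !=set0 -> B = B') ->
  (forall y, exists2 B, P B & B y) ->
  P C -> C x -> connected_component [set: X] x = C.
Proof.
move=> Poc Pdisj Pcov PC Cx; have [Co Cc] := Poc C PC.
have Ccl : closed C.
  rewrite -openC (_ : ~` C = \bigcup_(B in [set B | P B /\ B <> C]) B).
    by apply: bigcup_open => B [/Poc[]].
  apply/seteqP; split => [y nCy|y [B [PB BC] By] Cy].
    have [B PB By] := Pcov y; exists B => //; split => // BC.
    by rewrite BC in By.
  by apply: BC; apply: Pdisj => //; exists y.
apply/seteqP; split; last exact: connected_component_max.
have /(_ C) H := @component_connected _ [set: X] x.
have xx : connected_component [set: X] x x by exact: connected_component_refl.
have sub : C `<=` connected_component [set: X] x by exact: connected_component_max.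
have CI : C = connected_component [set: X] x `&` C.
  by rewrite setIC; apply/esym/setIidPl.
by rewrite -H; [|exists x|exists C|exists C].
Qed.

(** * The foliated atlas *)

Section atlas.
Variable R : realType.
Implicit Types (z w q : R * R) (c d : chart R (surf R)) (p : surf R).

Definition box z (r : R) : set (R * R) :=
  [set x | z.1 - r < x < z.1 + r] `*` [set y | z.2 - r < y < z.2 + r].

Lemma open_interval_oo (u v : R) : open_interval [set x : R | u < x < v].
Proof.
by exists u%:E, v%:E; apply/seteqP; split => x /=; rewrite !lte_fin.
Qed.

Lemma open_box_oo (u v u' v' : R) :
  open_box ([set x : R | u < x < v] `*` [set y : R | u' < y < v']).
Proof.
by exists [set x : R | u < x < v], [set y : R | u' < y < v'];
  split => //; exact: open_interval_oo.
Qed.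

Lemma open_oo (u v : R) : open [set x : R | u < x < v].
Proof.
have -> : [set x : R | u < x < v] = `]u, v[%classic.
  by apply/seteqP; split => x /=; rewrite in_itv.
exact: interval_open.
Qed.

Lemma open_oo2 (u v u' v' : R) :
  open ([set x : R | u < x < v] `*` [set y : R | u' < y < v']).
Proof.
rewrite openE => w [w1 w2]; exists ([set x | u < x < v], [set y | u' < y < v']) => //.
by split; apply: open_nbhs_nbhs; split => //; exact: open_oo.
Qed.

Lemma box_center z r : 0 < r -> box z r z.
Proof. by move=> r0; split => /=; lra. Qed.

Lemma box_open z r : open (box z r).
Proof. exact: open_oo2. Qed.

Lemma near_box z (P : set (R * R)) : (\forall w \near z, P w) ->
  exists2 r, 0 < r & box z r `<=` P.
Proof.
move=> /nbhs_ballP[e e0 eP]; exists e => // w [/= w1 w2].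
by apply: eP; split; rewrite /ball /= ltr_norml; lra.
Qed.

(** A box of radius [1 / 4] contains at most one lattice point. *)
Lemma lattice_box z : ~ lattice z ->
  exists r, 0 < r <= 4^-1 /\ forall w, box z r w -> ~ lattice w.
Proof.
move=> nz; have [[g lg gz]|none] :=
    pselect (exists2 g, lattice g & box z 4^-1 g); last first.
  by exists 4^-1; split => [|w bw lw]; [lra|apply: none; exists w].
pose r := Num.min 4^-1 (Num.max `|g.1 - z.1| `|g.2 - z.2|).
have r0 : 0 < r.
  rewrite lt_min lt_max !normr_gt0; apply/andP; split; first lra.
  rewrite -negb_and !subr_eq0; apply/negP => /andP[/eqP g1 /eqP g2].
  by apply: nz; rewrite (_ : z = g)//; case: (z) (g) g1 g2 => ? ? [? ?] /= -> ->.
have r4 : r <= 4^-1 by rewrite ge_min lexx.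
exists r; split; first by rewrite r0.
move=> w [/= w1 w2] lw; move: gz => [/= g1 g2].
have wg : w = g.
  apply/eqP; rewrite -subr_eq0; apply/eqP; apply: lattice_discrete.
  - exact: latticeB.
  - by rewrite /= ltr_norml; lra.
  - by rewrite /= ltr_norml; lra.
have : r <= Num.max `|g.1 - z.1| `|g.2 - z.2| by rewrite ge_min lexx orbT.
rewrite -wg le_max !ler_normr; lra.
Qed.

Lemma flat_open (A : set (R * R)) : open A -> (forall w, A w -> ~ lattice w) ->
  open (flat @` A).
Proof.
move=> Ao nA; rewrite surf_openE; split => [z nz [q Aq qz]|c c1 [q Aq]].
  have lzq := flat_inj nz (nA _ Aq) (esym qz).
  have : \forall w \near q, A w by exact: open_nbhs_nbhs.
  move=> /(@translate_near _ z); apply: filterS => w Aw.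
  by exists (w - (z - q)) => //; apply/esym/flat_eq; rewrite subKr.
by move=> /flat_neq_long [].
Qed.

Lemma flat_cvg z : ~ lattice z -> {for z, continuous flat}.
Proof.
move=> nz U; rewrite {1}nbhsE => -[V [Vo Vz] VU].
by have [+ _] := Vo => /(_ z nz Vz); apply: filterS => w /VU.
Qed.

Definition torus_chart c : Prop := exists z r,
  [/\ 0 < r <= 4^-1, forall w, box z r w -> ~ lattice w,
      chart_dom c = flat @` box z r, chart_cod c = box z r
    & forall w, box z r w -> chart_map c (flat w) = w].

Lemma torus_chart_ex z (e : R) : ~ lattice z -> 0 < e ->
  exists c r, [/\ 0 < r < e, torus_chart c, chart_dom c = flat @` box z r
    & forall w, box z r w -> chart_map c (flat w) = w].
Proof.
move=> nz e0; have [r [/andP[r0 r4] rn]] := lattice_box nz.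
pose s := Num.min r (e / 2).
have sr : s <= r by rewrite ge_min lexx.
have se : s <= e / 2 by rewrite ge_min lexx orbT.
have s0 : 0 < s by rewrite lt_min r0; lra.
have bsr w : box z s w -> box z r w by move=> [/= ? ?]; split => /=; lra.
pose phi p := xget 0 [set w | box z s w /\ flat w = p].
have phiK w : box z s w -> phi (flat w) = w.
  move=> bw; rewrite /phi; case: xgetP => [w' _ [bw' /flat_inj]|/(_ w)[]//].
  move=> /(_ (rn _ (bsr _ bw')) (rn _ (bsr _ bw))) /lattice_discrete ww'.
  apply/eqP; rewrite -subr_eq0; apply/eqP; apply: ww'.
    by rewrite ltr_norml /=; case: bw bw' => /= ? ? [/= ? ?]; lra.
  by rewrite ltr_norml /=; case: bw bw' => /= ? ? [/= ? ?]; lra.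
have bn w : box z s w -> ~ lattice w by move=> /bsr /rn.
have [c [cdom ccod cmap]] : exists c : chart R (surf R),
    [/\ chart_dom c = flat @` box z s, chart_cod c = box z s & chart_map c = phi].
  apply: (chart_of (flat z)).
  - by apply: flat_open => //; exact: box_open.
  - exact: box_open.
  - by move=> _ [w bw <-]; rewrite phiK.
  - move=> _ _ /set_mem[w bw <-] /set_mem[w' bw' <-].
    by rewrite !phiK// => ->.
  - by move=> w bw; exists (flat w); [exists w|exact: phiK].
  - move=> _ [w bw <-] U; rewrite phiK// => /near_box[t t0 tU].
    have : \forall p \near flat w, (flat @` (box z s `&` box w t)) p.
      apply: open_nbhs_nbhs; split; last first.
        by exists w => //; split => //; exact: box_center.
      apply: flat_open; first by apply: openI; exact: box_open.
      by move=> v [/bn].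
    by apply: filterS => _ [v [bv wv] <-]; rewrite /= phiK//; exact: tU.
  - move=> _ V Vo [w bw <-] Vw; rewrite phiK//.
    have : \forall v \near w, V (flat v).
      by apply: (flat_cvg (bn _ bw)); exact: open_nbhs_nbhs.
    by apply: filterS => v Vv _ [u bu <-]; rewrite phiK// => ->.
exists c, s; split => //; first by rewrite s0; lra.
  exists z, s; split => //.
  - by rewrite s0; lra.
  - by move=> w bw; rewrite cmap phiK.
by move=> w bw; rewrite cmap phiK.
Qed.

Definition collar_chart c : Prop := exists (h : nat -> omega1) (b : omega1)
    (u v r : R),
  let B := [set x | u < x < v] `*` [set y | - r < y < r] in
  [/\ range h = [set a | (a <= b)%O], chart_dom c = collar b `&` collar_map h @^-1` B,
      chart_cod c = B & chart_map c = collar_map h].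

(** The box must be small enough for each of its points to have a preimage. Off the
    axis this is the intermediate value theorem on a horizontal segment from the
    line [x = - 1 / 8] to a curve beyond [t]; the bounds [u] and [v] are chosen
    between the limiting values at its ends and the coordinate of [t]. *)
Lemma collar_chart_ex (t : closed_long_ray R) h : t.1 != omega1_0 ->
  range h = [set a | (a <= t.1)%O] ->
  exists c, [/\ collar_chart c, chart_dom c (long t) & chart_map c = collar_map h].
Proof.
move=> t1 hP; have pt := near_puncture_lt t1.
have [a [d [/andP[pa ta] td d1 _ _]]] := coord_between hP pt (lexx t.1) ltr01.
have p0 := near_puncture_gt0 R.
have d0 := lt_trans (lt_trans p0 pt) td.
pose u := (coord h (near_puncture R) + coord h t) / 2.
pose v := (coord h t + coord h d) / 2.
have pt1 : ((near_puncture R).1 <= t.1)%O by exact: omega1_0_le.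
have cpt := coord_lt hP pt1 pt; have ctd := coord_lt hP (lexx _) td.
have near_y : \forall y \near (0 : R)^', [/\ `|y| < 4^-1,
    plane_coord h (- 8^-1, y) < u & v < plane_coord h (curve d y, y)].
  have sp := plane_coord_curve (h := h) p0; have sd := plane_coord_curve (h := h) d0.
  near=> y; split.
  - by near: y; apply: dnbhs0_lt; lra.
  - rewrite -(curve_near_puncture y).
    by near: y; apply: (cvgr_lt _ sp); rewrite /u; lra.
  - by near: y; apply: (cvgr_gt _ sd); rewrite /v; lra.
have [r r0 rP] : exists2 r, 0 < r & forall y, y != 0 -> - r < y < r ->
    [/\ `|y| < 4^-1, plane_coord h (- 8^-1, y) < u & v < plane_coord h (curve d y, y)].
  have /nbhs_ballP[r r0 rP] := near_y; exists r => // y y0 yr.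
  by apply: rP => //; rewrite /ball /= sub0r normrN ltr_norml.
pose B := [set x | u < x < v] `*` [set y | - r < y < r].
have Bo : open B by exact: open_oo2.
have tE : collar_map h (long t) = (coord h t, 0) by rewrite collar_map_long.
have [c [cdom ccod cmap]] : exists c : chart R (surf R),
    [/\ chart_dom c = collar t.1 `&` collar_map h @^-1` B, chart_cod c = B
      & chart_map c = collar_map h].
  apply: (chart_of (long t)) => //.
  - exact: collar_open.
  - by move=> p [].
  - by move=> p p' /set_mem[cp _] /set_mem[cp' _]; apply: collar_inj hP _ _ _ _;
       exact/mem_set.
  - move=> z Bz; suff [p cp pz] : exists2 p, collar t.1 p & collar_map h p = z.
      by exists p => //; split => //; rewrite /= pz.
    move: Bz => [/= z1 z2]; have [z20|z20] := eqVneq z.2 0.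
      have [|s st sz] := coord_surj hP (v := z.1).
        have := coord_ge0 h (near_puncture R).
        have := coord_lt1 hP (c := d); rewrite d1 lexx => /(_ isT).
        by rewrite /u /v in z1; lra.
      have ps : (near_puncture R < s)%O.
        by apply: (coord_lt_cancel (h := h)); rewrite sz; rewrite /u in z1; lra.
      have [cs csE] := collar_long h ps st.
      by exists (long s) => //; rewrite csE sz -z20; case: (z).
    have [y4 yu yv] := rP _ z20 z2.
    have d_lt0 := curve_lt0 d0 z20.
    have [||x /andP[x8 xd] xz] := plane_coord_ivt hP (y := z.2) (v := z.1) (x0 := - 8^-1) d_lt0.
    + by apply/andP; split; lra.
    + by lra.
    have wxz : window (x, z.2).
      by move: y4; rewrite ltr_norml => y4; apply/andP; split => /=; lra.
    exists (flat (x, z.2)); first exact: collar_flat.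
    by rewrite collar_map_flat// xz; case: (z).
  - move=> p [cp Bp] U; rewrite /= {1}nbhsE => -[V [Vo Vp] VU].
    have : \forall q \near p, (collar t.1 `&` collar_map h @^-1` V) q.
      by apply: open_nbhs_nbhs; split => //; exact: collar_open.
    by apply: filterS => q [_ /VU].
  - move=> p V Vo [cp Bp] Vp; have := collar_open_map hP Vo cp Vp.
    by apply: filterS => z zV q [cq _]; exact: zV.
exists c; split => //.
- by exists h, t.1, u, v, r.
- rewrite cdom; split; first by left; exists t.
  by rewrite /= tE; split => /=; rewrite /u /v; lra.
Unshelve. all: by end_near. Qed.

End atlas.

Section base_atlas.
Variable R : realType.
Implicit Types (z w q : R * R) (c d : chart R (surf R)) (p : surf R).

Definition base_atlas : set (chart R (surf R)) :=
  [set c | torus_chart c \/ collar_chart c].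

(** Both kinds of charts measure the height of a point up to a lattice
    translation, so that their coordinate changes are horizontal. *)
Lemma base_height c z : base_atlas c -> ~ lattice z -> chart_dom c (flat z) ->
  exists k, \forall w \near z, (chart_map c (flat w)).2 = w.2 + k.
Proof.
have shift (A : set (R * R)) q (f : surf R -> R) : open A -> A q ->
    (forall w, A w -> f (flat w) = w.2) -> lattice (z - q) ->
    exists k, \forall w \near z, f (flat w) = w.2 + k.
  move=> Ao Aq fA zq; exists (- (z - q).2).
  have : \forall w \near q, A w by exact: open_nbhs_nbhs.
  move=> /(@translate_near _ z); apply: filterS => w Aw.
  have -> : flat w = flat (w - (z - q)) by apply: flat_eq; rewrite subKr.
  by rewrite fA.
move=> [[z0 [r [_ rn -> _ cmap]]]|[h [b [u [v [r [hP -> _ cmap]]]]]]] nz cz.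
  have [q bq qz] := cz.
  apply: (shift (box z0 r) q (fun p => (chart_map c p).2)) => //.
  - exact: box_open.
  - by move=> w /cmap ->.
  - exact: flat_inj nz (rn _ bq) (esym qz).
have [[[t [t1 _ fl]]|[q wq qz]] _] := cz; first by case: (flat_neq_long t1 fl).
apply: (shift (@window R) q (fun p => (chart_map c p).2)) => //.
- exact: window_open.
- by move=> w ww; rewrite cmap collar_map_flat.
- exact: flat_inj nz (window_not_lattice wq) (esym qz).
Qed.

Lemma base_long c (t : closed_long_ray R) : base_atlas c -> t.1 != omega1_0 ->
  chart_dom c (long t) -> collar_chart c.
Proof.
by move=> [[z0 [r [_ rn -> _ _]]]|//] t1 [q bq /(flat_neq_long t1)].
Qed.

Lemma collar_map_height (h h' : nat -> omega1) p :
  (collar_map h p).2 = (collar_map h' p).2.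
Proof. by rewrite /collar_map; case: (val p). Qed.

Lemma base_atlas_foliated : foliated_atlas base_atlas.
Proof.
split.
- move=> p; have [[z nz ->]|[t t1 ->]] := surf_cases p.
    have [c [r [/andP[r0 _] tc cdom _]]] := torus_chart_ex nz ltr01.
    by exists c; [left|rewrite cdom; exists z => //; exact: box_center].
  have [h hP] := omega1_enum t.1.
  have [c [cc ct _]] := collar_chart_ex t1 hP.
  by exists c => //; right.
- move=> c [[z [r [_ _ _ -> _]]]|[h [b [u [v [r [_ _ -> _]]]]]]].
    exact: open_box_oo.
  exact: open_box_oo.
- move=> c d cA dA; apply/foliated_changeE => p cp dp.
  have [[z nz pz]|[t t1 pt]] := surf_cases p; last first.
    rewrite pt in cp dp.
    have [h [b [u [v [r [_ _ _ cmap]]]]]] := base_long cA t1 cp.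
    have [h' [b' [u' [v' [r' [_ _ _ dmap]]]]]] := base_long dA t1 dp.
    exists id.
    have : \forall w \near chart_map c p, chart_cod c w.
      apply: open_nbhs_nbhs; split; first exact: chart_cod_open.
      by rewrite pt; exact: chart_map_cod.
    apply: filterS => w /(@chart_invK _ _ c) wK.
    by rewrite dmap (collar_map_height h' h) -cmap wK.
  rewrite pz in cp dp *.
  have [k kP] := base_height cA nz cp; have [k' k'P] := base_height dA nz dp.
  exists (fun y => y - k + k').
  have [r [/andP[r0 _] rn]] := lattice_box nz.
  have [s s0 sP] := near_box (filterI kP k'P).
  have : \forall q \near flat z, (flat @` (box z r `&` box z s)) q.
    apply: open_nbhs_nbhs; split; last first.
      by exists z => //; split; exact: box_center.
    apply: flat_open; first by apply: openI; exact: box_open.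
    by move=> w [/rn].
  move=> /(chart_inv_cvg cp).
  have : \forall w \near chart_map c (flat z), chart_cod c w.
    by apply: open_nbhs_nbhs; split; [exact: chart_cod_open|exact: chart_map_cod].
  apply: filterS2 => x cx [w [_ /sP[cw dw]] wx].
  by rewrite -wx dw -[in RHS](chart_invK cx) -wx cw addrK.
Qed.

Definition surf_foliation : foliation R (surf R) :=
  sval (cid2 (foliation_of_atlas base_atlas_foliated)).

Lemma base_atlas_sub : base_atlas `<=` foliation_atlas surf_foliation.
Proof. by rewrite /surf_foliation; case: cid2. Qed.

Lemma base_atlas_transverse c d :
  foliation_atlas surf_foliation c -> base_atlas d -> transverse d c.
Proof. by rewrite /surf_foliation; case: cid2 => F /= _ +; apply. Qed.

End base_atlas.

(** * The leaves *)

Section leaves.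
Variable R : realType.
Implicit Types (z w q : R * R) (c d : chart R (surf R)) (p : surf R).
Implicit Types (s t : closed_long_ray R).

Local Notation F := (surf_foliation R).

(** A leaf of the torus, or an open part of it when [u] is not surjective. *)
Definition flat_line (u : R -> R) (y : R) (x : R) : surf R := flat (u x, y).

Section flat_lines.
Variables (u : R -> R) (y : R).
Hypotheses (u_inj : injective u) (u_cont : continuous u).
Hypothesis u_open : forall J, open J -> open (u @` J).
Hypothesis u_lattice : forall x, ~ lattice (u x, y).

Lemma flat_line_inj : injective (flat_line u y).
Proof.
move=> x x' /flat_inj => /(_ (@u_lattice x) (@u_lattice x')) /lattice_horizontal.
by rewrite /= subrr => /(_ erefl) [] /eqP; rewrite subr_eq0 => /eqP /u_inj.
Qed.

Lemma pair_cvg x : (u x', y) @[x' --> x] --> (u x, y).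
Proof.
by apply: (@cvg_pair _ _ _ (nbhs x) (nbhs (u x)) (nbhs y)); [exact: u_cont|exact: cvg_cst].
Qed.

Lemma flat_line_continuous_surf : continuous (flat_line u y).
Proof.
move=> x; apply: (@continuous_cvg _ _ _ _ _ (fun x => (u x, y)) flat).
  exact: flat_cvg.
exact: pair_cvg.
Qed.

Lemma flat_line_continuous : continuous (flat_line u y : R -> leaf_space F).
Proof.
apply: (horizontal_continuous (@base_atlas_transverse R)) => [|x].
  exact: flat_line_continuous_surf.
have [c [r [/andP[r0 _] tc cdom cmap]]] := torus_chart_ex (@u_lattice x) ltr01.
exists c; split; first by left.
  by rewrite cdom; exists (u x, y) => //; exact: box_center.
have : \forall x' \near x, box (u x, y) r (u x', y).
  apply: pair_cvg; apply: open_nbhs_nbhs.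
  by split; [exact: box_open|exact: box_center].
by apply: filterS => x' bx'; rewrite /flat_line !cmap//; exact: box_center.
Qed.

Lemma flat_line_open (J : set R) : open J ->
  open (flat_line u y @` J : set (leaf_space F)).
Proof.
move=> Jo; apply: (plaquewise_open (@base_atlas_sub R)) (Jo).
move=> x K Ko Kx.
have /nbhs_ballP[e /= e0 eK] : nbhs (u x) (u @` K).
  by apply: open_nbhs_nbhs; split; [exact: u_open|exists x].
have [c [r [/andP[r0 re] tc cdom cmap]]] := torus_chart_ex (@u_lattice x) e0.
have bx : box (u x, y) r (u x, y) by exact: box_center.
exists c, y, setT; split; [by left|exact: openT|split=> //|].
  split; first by rewrite cdom; exists (u x, y).
  by rewrite /= /flat_line cmap.
move=> p [[]]; rewrite cdom => -[w bw <-] /=; rewrite cmap// => wy _.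
have [|x' Kx' x'w] := eK w.1.
  by rewrite /ball /= ltr_norml; move: bw => [/= ? _]; lra.
by exists x' => //; rewrite /flat_line x'w -wy; case: (w).
Qed.

Lemma flat_line_homeomorphic :
  homeomorphic (range (flat_line u y) : set (leaf_space F)) R.
Proof.
apply: homeomorphic_range; first exact: flat_line_inj.
  exact: flat_line_continuous.
exact: flat_line_open.
Qed.

Lemma connected_R : connected [set: R].
Proof. by apply/connected_intervalP. Qed.

Lemma flat_line_leaf : open (range (flat_line u y) : set (leaf_space F)) /\
  connected (range (flat_line u y) : set (leaf_space F)).
Proof.
split; first by apply: flat_line_open; exact: openT.
apply: connected_continuous_connected; first exact: connected_R.
exact/continuous_subspaceT/flat_line_continuous.
Qed.

End flat_lines.

End leaves.

Section long_leaf.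
Variable R : realType.
Implicit Types (z w q : R * R) (c d : chart R (surf R)) (p : surf R).
Implicit Types (s t : closed_long_ray R).

Local Notation F := (surf_foliation R).

Lemma near_long_itv s t t' : (s < t < t')%O ->
  \forall r \near t, (s < r < t')%O.
Proof.
move=> st; have := @itv_open _ (order_topology (omega1 *l ico01 R)) s t'.
rewrite openE => /(_ t) H.
have : [set` `]s, t'[%O] t by rewrite /= in_itv.
by move=> /H; apply: filterS => r; rewrite /= in_itv.
Qed.

Lemma long_after t : exists t', (t < t')%O /\ t'.1 = t.1.
Proof.
exists (mk_long t.1 ((1 + val t.2) / 2)); split=> //.
have := ico_ge0 t; have := ico_lt1 t => t1 t0.
by apply/long_ltP; right; split => //; rewrite mk_longK; lra.
Qed.

Lemma nbhs_long_itv t (U : set (closed_long_ray R)) : (long0 R < t)%O ->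
  nbhs t U -> exists s t', [/\ (long0 R <= s)%O, (s < t < t')%O
    & forall r, (s < r < t')%O -> U r].
Proof.
move=> t0; have [ta [tta _]] := long_after t.
have le0 r : (long0 R <= r)%O.
  rewrite leNgt; apply/negP => /long_ltP [|[_]] /=.
    by rewrite ltNge omega1_0_le.
  by rewrite ltNge ico_ge0.
rewrite (@order_nbhs_itv _ (omega1 *l ico01 R)%type t) => -[[i j] [/= ij tij] UU].
have [s [s0 st sP]] : exists s, [/\ (long0 R <= s)%O, (s < t)%O
    & forall r, (s < r)%O -> (i <= BLeft r)%O].
  case: i ij tij {UU} => [[] l|[]] //= ij; rewrite itv_boundlr => /andP[lt _].
  - by exists l; split.
  - by exists (long0 R).
have [t' [tt' tP]] : exists t', (t < t')%O /\
    forall r, (r < t')%O -> (BRight r <= j)%O.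
  case: j ij tij {UU} => [[] l|[]] //= ij; rewrite itv_boundlr => /andP[_ lt].
  - by exists l.
  - by case: i ij {sP} => [[]|[]].
  - by case: i ij {sP} => [[]|[]].
  - by exists ta.
exists s, t'; split => // [|r /andP[sr rt']]; first by rewrite st.
by apply: UU; rewrite /= itv_boundlr sP// tP.
Qed.

(** On its first segment the long ray is parametrized by [1 - 1 / t]. *)
Lemma axis_interval t (P : set R) : t.1 = omega1_0 -> (long0 R < t)%O ->
  (\forall x \near 1 - (val t.2)^-1, P x) ->
  exists s t', [/\ (long0 R < s)%O, (s < t < t')%O
    & forall r, (s < r < t')%O -> r.1 = omega1_0 /\ P (1 - (val r.2)^-1)].
Proof.
move=> t1 t0 xP; have t2 := long0_lt t0 t1; have t2' := ico_lt1 t.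
have : \forall v \near val t.2, P (1 - v^-1).
  have : (1 - v^-1) @[v --> val t.2] --> 1 - (val t.2)^-1.
    apply: cvgB; first exact: cvg_cst.
    by apply: cvgV; [rewrite gt_eqF|exact: cvg_id].
  exact.
move=> /nbhs_ballP[e /= e0 eP].
pose k := Num.min e (Num.min (val t.2) (1 - val t.2)) / 2.
have k0 : 0 < k by rewrite divr_gt0// !lt_min e0 t2 subr_gt0 t2'.
have ke : k < e.
  have : Num.min e (Num.min (val t.2) (1 - val t.2)) <= e by rewrite ge_min lexx.
  by rewrite /k in k0 *; lra.
have kt : k < val t.2.
  have : Num.min e (Num.min (val t.2) (1 - val t.2)) <= val t.2.
    by rewrite !ge_min lexx orbT.
  by rewrite /k in k0 *; lra.
have k1 : k < 1 - val t.2.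
  have : Num.min e (Num.min (val t.2) (1 - val t.2)) <= 1 - val t.2.
    by rewrite !ge_min lexx !orbT.
  by rewrite /k in k0 *; lra.
have sE : val (mk_long (R := R) omega1_0 (val t.2 - k)).2 = val t.2 - k.
  by rewrite mk_longK; lra.
have tE : val (mk_long (R := R) omega1_0 (val t.2 + k)).2 = val t.2 + k.
  by rewrite mk_longK; lra.
exists (mk_long omega1_0 (val t.2 - k)), (mk_long omega1_0 (val t.2 + k)).
split.
- apply/long_ltP; right; split => //; rewrite sE.
  by change (0 < val t.2 - k); lra.
- by apply/andP; split; apply/long_ltP; right; rewrite ?sE ?tE t1; split=> //; lra.
- move=> r /andP[/long_ltP sr /long_ltP rt].
  have r1 : r.1 = omega1_0.
    by case: rt => [|[]//] /=; rewrite ltNge omega1_0_le.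
  split => //; apply: eP; rewrite /ball /= ltr_norml.
  move: sr rt; rewrite r1 sE tE /= ltxx => -[//|[_ sr]] [//|[_ rt]].
  by lra.
Qed.

Lemma flat_axis_near (x : R) (V : set (surf R)) : x != 0 -> open V ->
  V (flat (x, 0)) -> \forall x' \near x, V (flat (x', 0)).
Proof.
move=> x0 Vo Vx; have : (x', 0 : R) @[x' --> x] --> (x, 0 : R).
  by apply: (@cvg_pair _ _ _ (nbhs x) (nbhs x) (nbhs (0 : R))); [exact: cvg_id|exact: cvg_cst].
have [+ _] := Vo => /(_ _ (axis_not_lattice x0) Vx) Vw xw.
exact: (xw (fun w => V (flat w)) Vw).
Qed.

Lemma long_interval t (V : set (surf R)) : (long0 R < t)%O -> open V ->
  V (long t) -> exists s t', [/\ (long0 R < s)%O, (s < t < t')%O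
    & forall r, (s < r < t')%O -> V (long r)].
Proof.
move=> t0 Vo Vt; have [t1|t1] := eqVneq t.1 omega1_0; last first.
  have [_ /(_ t t1 Vt) [s [t' [s0 st [VL _]]]]] := Vo.
  by exists s, t'.
have x0 := long_axis_neg t1 t0.
rewrite long_flat// in Vt.
have [|s [t' [s0 st sP]]] := axis_interval t1 t0 (P := fun x => V (flat (x, 0))).
  by apply: flat_axis_near => //; rewrite lt_eqF.
by exists s, t'; split => // r /sP [r1 Vr]; rewrite long_flat.
Qed.

(** The parametrization of the long leaf, now with the topological type that is to
    be compared with it as source. *)
Definition long_curve (s : long_ray R) : surf R := long (set_val s).

Lemma long_ray_gt0 (s : long_ray R) : (long0 R < set_val s)%O.
Proof.
have /= := set_mem (valP s); rewrite -/(long0 R) => s0.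
rewrite ltNge le_eqVlt; apply/negP => /orP[/eqP//|].
move=> /long_ltP[|[_]] /=; first by rewrite ltNge omega1_0_le.
by rewrite ltNge ico_ge0.
Qed.

Lemma long_ray_ex t : (long0 R < t)%O -> exists s : long_ray R, set_val s = t.
Proof.
move=> t0; have nt : t \in ~` [set closed_long_ray0 R].
  by rewrite inE /= => tE; move: t0; rewrite tE ltxx.
by exists (exist _ t nt).
Qed.

Lemma long_ray_near (s : long_ray R) (P : set (closed_long_ray R)) :
  (\forall t \near set_val s, P t) -> \forall r \near s, P (set_val r).
Proof. by move=> H; apply: (@initial_continuous _ _ set_val s). Qed.

Lemma long_curve_inj : injective long_curve.
Proof.
move=> s s' /long_inj ss'; apply/val_inj/ss'; exact: long_ray_gt0.
Qed.

Lemma long_curve_continuous_surf : continuous long_curve.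
Proof.
move=> s U; rewrite {1}nbhsE => -[V [Vo Vs] VU].
have [a [t' [_ st sP]]] := long_interval (long_ray_gt0 s) Vo Vs.
apply: (@long_ray_near s (fun t => U (long t))).
by apply: filterS (near_long_itv st) => r /sP /VU.
Qed.

Lemma long_curve_continuous : continuous (long_curve : long_ray R -> leaf_space F).
Proof.
apply: (horizontal_continuous (@base_atlas_transverse R)) => [|s].
  exact: long_curve_continuous_surf.
have s0 := long_ray_gt0 s; set t := set_val s.
have [t1|t1] := eqVneq t.1 omega1_0.
  have x0 := long_axis_neg t1 s0.
  have nx : ~ lattice (1 - (val t.2)^-1, 0) by apply: axis_not_lattice; rewrite lt_eqF.
  have [c [r [/andP[r0 _] tc cdom cmap]]] := torus_chart_ex nx ltr01.
  have bx : box (1 - (val t.2)^-1, 0) r (1 - (val t.2)^-1, 0) by exact: box_center.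
  exists c; split; first by left.
    by rewrite cdom /long_curve long_flat//; exists (1 - (val t.2)^-1, 0).
  have [|a [t' [_ st sP]]] := axis_interval t1 s0
      (P := fun x => box (1 - (val t.2)^-1, 0) r (x, 0)).
    have := bx; move=> [/= bx1 bx2].
    have : \forall x \near 1 - (val t.2)^-1,
        x \in `]1 - (val t.2)^-1 - r, 1 - (val t.2)^-1 + r[.
      by apply: near_in_itvoo; rewrite in_itv.
    by apply: filterS => x; rewrite in_itv.
  apply: (@long_ray_near s (fun r => (chart_map c (long r)).2 = (chart_map c (long t)).2)).
  by apply: filterS (near_long_itv st) => q /sP [q1 bq]; rewrite !long_flat// !cmap.
have [h hP] := omega1_enum t.1.
have [c [cc ct cmap]] := collar_chart_ex t1 hP.
exists c; split => //; first by right.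
have [t' [tt' t'1]] := long_after t.
have pt : (near_puncture R < t < t')%O by rewrite near_puncture_lt.
apply: (@long_ray_near s (fun r => (chart_map c (long r)).2 = (chart_map c (long t)).2)).
apply: filterS (near_long_itv pt) => q /andP[pq qt].
have q1 : (q.1 <= t.1)%O by rewrite -t'1; have /long_ltP[/ltW|[->]] := qt.
have [_ qE] := collar_long h pq q1.
by rewrite cmap qE collar_map_long.
Qed.

(** Around a new point the plaques of collar charts at height [0] are intervals of
    the long leaf, and the open set cuts them down to a prescribed interval. *)
Lemma long_curve_open (J : set (long_ray R)) : open J ->
  open (long_curve @` J : set (leaf_space F)).
Proof.
move=> Jo; apply: (plaquewise_open (@base_atlas_sub R)) (Jo).
move=> s K Ko Ks {J Jo}.
have s0 := long_ray_gt0 s; set t := set_val s in s0 *.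
have [a [d [_ ad KP]]] : exists a d : closed_long_ray R,
    [/\ (long0 R <= a)%O, (a < t < d)%O
    & forall r : long_ray R, (a < set_val r < d)%O -> K r].
  have [W Wo WK] := Ko; rewrite -WK in Ks.
  have [|a [d [a0 ad adW]]] := nbhs_long_itv s0 (U := W).
    exact: open_nbhs_nbhs.
  by exists a, d; split => // r /adW; rewrite -WK.
have imK r : (long0 R < r)%O -> (a < r < d)%O -> (long_curve @` K) (long r).
  by move=> /long_ray_ex[r' <-] adr; exists r' => //; exact: KP.
have [at_ td] := andP ad.
have [t1|t1] := eqVneq t.1 omega1_0.
  have x0 := long_axis_neg t1 s0.
  have nx : ~ lattice (1 - (val t.2)^-1, 0) by apply: axis_not_lattice; rewrite lt_eqF.
  have a1 : a.1 = omega1_0.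
    have /long_ltP[|[-> //]] := at_.
    by rewrite t1 ltNge omega1_0_le.
  have at2 : val a.2 < val t.2.
    have /long_ltP[|[_ //]] := at_.
    by rewrite t1 ltNge omega1_0_le.
  have td2 : d.1 = omega1_0 -> val t.2 < val d.2.
    by move=> d1; have /long_ltP[|[_ //]] := td; rewrite d1 ltNge omega1_0_le.
  have [e e0 eP] : exists2 e, 0 < e & forall x, `|x - (1 - (val t.2)^-1)| < e ->
      (long_curve @` K) (flat (x, 0)).
    have inv_cvg : (1 - x)^-1 @[x --> 1 - (val t.2)^-1] --> val t.2.
      have : (1 - x)^-1 @[x --> 1 - (val t.2)^-1] --> (1 - (1 - (val t.2)^-1))^-1.
        apply: cvgV; first by rewrite subKr invr_eq0 gt_eqF// (long0_lt s0 t1).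
        by apply: cvgB; [exact: cvg_cst|exact: cvg_id].
      by rewrite subKr invrK.
    suff /nbhs_ballP[e /= e0 eP] : \forall x \near 1 - (val t.2)^-1,
        (long_curve @` K) (flat (x, 0)).
      by exists e => // x xe; apply: eP; rewrite /ball /= distrC.
    have near_d : \forall x \near 1 - (val t.2)^-1,
        d.1 = omega1_0 -> (1 - x)^-1 < val d.2.
      have [/td2 d2|] := pselect (d.1 = omega1_0); last by move=> nd; near=> x => /nd.
      by near=> x => _; near: x; exact: (cvgr_lt _ inv_cvg).
    near=> x.
    have xn : x < 0 by near: x; exact: lt_nbhsl.
    have ax : val a.2 < (1 - x)^-1 by near: x; exact: (cvgr_gt _ inv_cvg).
    have xd : d.1 = omega1_0 -> (1 - x)^-1 < val d.2 by near: x.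
    have [r [r1 r0 xE <-]] := axis_long xn.
    have r2 : val r.2 = (1 - x)^-1 by rewrite xE subKr invrK.
    apply: imK => //; apply/andP; split; apply/long_ltP.
      by right; rewrite a1 r1 r2.
    have [d1|d1] := eqVneq d.1 omega1_0; first by right; rewrite r1 d1 r2 xd.
    by left; rewrite r1 lt_neqAle eq_sym d1 omega1_0_le.
  have [c [r [/andP[r0 re] tc cdom cmap]]] := torus_chart_ex nx e0.
  have bx : box (1 - (val t.2)^-1, 0) r (1 - (val t.2)^-1, 0) by exact: box_center.
  exists c, 0, setT; split; [by left|exact: openT|split=> //|].
    split; first by rewrite cdom /long_curve long_flat//; exists (1 - (val t.2)^-1, 0).
    by rewrite /= /long_curve long_flat// cmap.
  move=> p [[]]; rewrite cdom => -[w bw <-] /=; rewrite cmap// => w2 _.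
  have -> : w = (w.1, 0) by rewrite -w2; case: (w).
  by apply: eP; move: bw => [/= w1 _]; rewrite ltr_norml; lra.
have [h hP] := omega1_enum t.1.
have [c [cc ct cmap]] := collar_chart_ex t1 hP.
have a1 : (a.1 <= t.1)%O by have /long_ltP[/ltW|[->]] := at_.
have cat := coord_lt hP a1 at_; have ctd := coord_lt hP (lexx _) td.
pose W := [set x : R | coord h a < x < coord h d] `*` [set y : R | - 1 < y < 1].
exists c, 0, (collar t.1 `&` collar_map h @^-1` W); split.
- by right.
- by apply: collar_open => //; exact: open_oo2.
- have tE : collar_map h (long t) = (coord h t, 0) by rewrite collar_map_long.
  split; first by split => //=; rewrite cmap /long_curve tE.
  split; first by left; exists t.
  by rewrite /= /long_curve tE; split => /=; [rewrite cat ctd|lra].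
- move=> p [[_ /= p2] [cp /= [Wp _]]]; rewrite cmap in p2.
  have [[q [wq q2 pq]]|[r [r0 r1 pr rE]]] := collar_cases h cp.
    by move: p2; rewrite pq collar_map_flat//= => /eqP; rewrite (negPf q2).
  rewrite pr; apply: imK => //; move: Wp; rewrite rE /= => /andP[ar rd].
  by rewrite !(coord_lt_cancel (h := h)).
Unshelve. all: by end_near. Qed.

Lemma long_curve_homeomorphic :
  homeomorphic (range long_curve : set (leaf_space F)) (long_ray R).
Proof.
apply: homeomorphic_range; first exact: long_curve_inj.
  exact: long_curve_continuous.
exact: long_curve_open.
Qed.

(** Every countable initial piece of the long ray is the image of an interval
    under the inverse of its coordinate. *)
Lemma coord_long0 (h : nat -> omega1) : coord h (long0 R) = 0.
Proof.
rewrite -(average0 R h); apply: eq_average => n.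
by rewrite /long_passage ltNge omega1_0_le /=; case: eqP.
Qed.

Lemma long_ray_connected : connected [set: long_ray R].
Proof.
have base0 : (long0 R < near_puncture R)%O := near_puncture_gt0 R.
have [r0 r0E] := long_ray_ex base0.
pose piece b : set (long_ray R) := [set r | ((set_val r).1 <= b)%O].
have -> : [set: long_ray R] = \bigcup_(b in [set: omega1]) piece b.
  apply/seteqP; split => // r _; exists (set_val r).1 => //.
  exact: lexx.
apply: bigcup_connected; first by exists r0 => b _; rewrite /piece /= r0E omega1_0_le.
move=> b _; have [h hP] := omega1_enum b.
have /choice[g gP] : forall v : R, exists r : long_ray R, v \in `]0, 1[ ->
    ((set_val r).1 <= b)%O /\ coord h (set_val r) = v.
  move=> v; have [|nv] := boolP (v \in `]0, 1[); last by exists r0.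
  rewrite in_itv /= => /andP[v0 v1].
  have [|c cb cv] := coord_surj hP (v := v); first by rewrite ltW.
  have c0 : (long0 R < c)%O.
    by apply: (coord_lt_cancel (h := h)); rewrite cv coord_long0.
  have [r rE] := long_ray_ex c0.
  by exists r => _; rewrite rE.
have -> : piece b = g @` `]0, 1[%classic.
  apply/seteqP; split => [r rb|_ [v /gP[gb _] <-] //].
  have c01 : coord h (set_val r) \in `]0, 1[.
    rewrite in_itv /= (coord_lt1 hP rb) andbT -[X in X < _](coord_long0 h).
    by apply: (coord_lt hP _ (long_ray_gt0 r)); exact: omega1_0_le.
  exists (coord h (set_val r)); first exact: c01.
  have [gb gE] := gP _ c01; apply: val_inj.
  have [lt|lt|//] := ltgtP (set_val (g (coord h (set_val r)))) (set_val r).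
    by have := coord_lt hP gb lt; rewrite gE ltxx.
  by have := coord_lt hP rb lt; rewrite gE ltxx.
apply: connected_continuous_connected.
  by apply/connected_intervalP; exact: interval_is_interval.
rewrite continuous_open_subspace; last exact: interval_open.
move=> v /set_mem v01 U; have [gb gE] := gP v v01.
rewrite /= {1}nbhsE => -[_ [[W Wo <-] Wv] WU].
have [|s [t' [_ /andP[sv vt] sW]]] := nbhs_long_itv (long_ray_gt0 (g v)) (U := W).
  exact: open_nbhs_nbhs.
have sb : (s.1 <= b)%O.
  by apply: le_trans gb; have /long_ltP[/ltW|[->]] := sv.
have near1 : \forall v' \near v, v' \in `]coord h s, coord h t'[.
  apply: near_in_itvoo; rewrite in_itv /= -gE.
  by rewrite (coord_lt hP sb sv) (coord_lt hP gb vt).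
have near2 : \forall v' \near v, v' \in `]0, 1[ by exact: near_in_itvoo.
suff : \forall v' \near v, U (g v') by [].
near=> v'; apply: WU; apply: sW.
have v'01 : v' \in `]0, 1[ by near: v'.
have : v' \in `]coord h s, coord h t'[ by near: v'.
have [_ v'E] := gP _ v'01; rewrite in_itv /= => /andP[sv' vt'].
by apply/andP; split; apply: (coord_lt_cancel (h := h)); rewrite v'E.
Unshelve. all: by end_near. Qed.

Lemma long_curve_leaf : open (range long_curve : set (leaf_space F)) /\
  connected (range long_curve : set (leaf_space F)).
Proof.
split; first by apply: long_curve_open; exact: openT.
apply: connected_continuous_connected; first exact: long_ray_connected.
exact/continuous_subspaceT/long_curve_continuous.
Qed.

End long_leaf.

Section all_leaves.
Variable R : realType.
Implicit Types (z w q : R * R) (p : surf R) (s t c : closed_long_ray R).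

Local Notation F := (surf_foliation R).

Definition lattice_height : set R :=
  [set y | exists n m : int, y = n%:~R * sqrt2 R + m%:~R].

(** The removal of the lattice point cuts the leaf at height [0] in two. This is the
    half [x > 0]; the half [x < 0] is prolonged by the long ray. *)
Definition punctured_leaf : set (leaf_space F) := range (flat_line expR 0).

Definition long_leaf_set : set (leaf_space F) := range (@long_curve R).

Definition leaf_family : set (set (leaf_space F)) :=
  [set L | [\/ L = long_leaf_set, L = punctured_leaf
             | exists2 y, ~ lattice_height y & L = range (flat_line id y)]].

Lemma expR_lattice (x : R) : ~ lattice (expR x, 0).
Proof. by apply: axis_not_lattice; rewrite gt_eqF// expR_gt0. Qed.

Lemma expR_image_open (J : set R) : open J -> open (expR @` J : set R).
Proof.
move=> Jo; rewrite openE => _ [x Jx <-].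
have : \forall v \near expR x, J (ln v).
  by apply: (continuous_ln (expR_gt0 x)); rewrite expRK; exact: open_nbhs_nbhs.
have : \forall v \near expR x, 0 < v by apply: lt_nbhsr; exact: expR_gt0.
by apply: filterS2 => v v0 Jv; exists (ln v) => //; rewrite lnK.
Qed.

Lemma height_lattice (x y : R) : ~ lattice_height y -> ~ lattice (x, y).
Proof. by move=> ny [n [m [_ yE]]]; apply: ny; exists n, m. Qed.

Lemma id_image_open (J : set R) : open J -> open (id @` J : set R).
Proof. by rewrite image_id. Qed.

Lemma id_continuous : continuous (id : R -> R).
Proof. by move=> x; exact: cvg_id. Qed.

Lemma punctured_leaf_homeomorphic : homeomorphic punctured_leaf R.
Proof.
apply: flat_line_homeomorphic; [exact: expR_inj|exact: continuous_expR|..].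
  exact: expR_image_open.
exact: expR_lattice.
Qed.

Lemma leaf_family_open L : leaf_family L -> open L /\ connected L.
Proof.
case=> [->|->|[y ny ->]].
- exact: long_curve_leaf.
- apply: flat_line_leaf; [exact: continuous_expR|..].
    exact: expR_image_open.
  exact: expR_lattice.
- apply: flat_line_leaf => //; [exact: id_continuous|exact: id_image_open|].
  by move=> x; exact: height_lattice.
Qed.

Lemma leaf_family_line L : leaf_family L -> L <> long_leaf_set ->
  homeomorphic L R.
Proof.
case=> [->//|-> _|[y ny ->] _]; first exact: punctured_leaf_homeomorphic.
apply: flat_line_homeomorphic => //; [exact: id_continuous|exact: id_image_open|].
by move=> x; exact: height_lattice.
Qed.

Lemma long_curve_ex t : (long0 R < t)%O -> long_leaf_set (long t).
Proof. by move=> /long_ray_ex[r <-]; exists r. Qed.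

Lemma long_leaf_axis (x : R) : x < 0 -> long_leaf_set (flat (x, 0)).
Proof. by move=> /axis_long[t [_ t0 _ <-]]; exact: long_curve_ex. Qed.

Lemma punctured_leaf_axis (x : R) : 0 < x -> punctured_leaf (flat (x, 0)).
Proof. by move=> x0; exists (ln x) => //; rewrite /flat_line lnK. Qed.

Lemma leaf_family_cover p : exists2 L, leaf_family L & L p.
Proof.
have [[[x y] nz ->]|[t t1 ->]] := surf_cases p; last first.
  exists long_leaf_set; first by constructor 1.
  by apply: long_curve_ex; apply: lt_trans (near_puncture_gt0 R) (near_puncture_lt t1).
have [[n [m yE]]|ny] := pselect (lattice_height y); last first.
  exists (range (flat_line id y)); first by constructor 3; exists y.
  by exists x.
have xy : flat (x, y) = flat (x - n%:~R, 0).
  apply: flat_eq; exists n, m; rewrite yE /=; congr (_, _) => /=; ring.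
rewrite xy; have [x0|x0|x0] := ltgtP (x - n%:~R) 0.
- by exists long_leaf_set; [constructor 1|exact: long_leaf_axis].
- by exists punctured_leaf; [constructor 2|exact: punctured_leaf_axis].
- case: nz; exists n, m; congr (_, _) => //; lra.
Qed.

Lemma long_leaf_points p : long_leaf_set p ->
  (exists2 t, t.1 != omega1_0 & p = long t) \/
  exists2 x : R, x < 0 & p = flat (x, 0).
Proof.
move=> [r _ <-]; have r0 := long_ray_gt0 r.
have [r1|r1] := eqVneq (set_val r).1 omega1_0; last by left; exists (set_val r).
right; exists (1 - (val (set_val r).2)^-1); first exact: long_axis_neg.
by rewrite /long_curve long_flat.
Qed.

Lemma leaf_family_disjoint L L' : leaf_family L -> leaf_family L' ->
  L `&` L' !=set0 -> L = L'.
Proof.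
have line_long y : ~ lattice_height y ->
    range (flat_line id y) `&` long_leaf_set !=set0 -> False.
  move=> ny [_ [[x _ <-] /long_leaf_points [[t t1 /flat_neq_long]|[x' x'0]]]].
    by case.
  move=> /flat_inj [].
  + exact: height_lattice.
  + by apply: axis_not_lattice; rewrite lt_eqF.
  + by move=> n [m [_ yE]]; apply: ny; exists n, m; rewrite -yE subr0.
have line_punctured y : ~ lattice_height y ->
    range (flat_line id y) `&` punctured_leaf !=set0 -> False.
  move=> ny [_ [[x _ <-] [x' _ /flat_inj]]] [].
  + exact: expR_lattice.
  + exact: height_lattice.
  + move=> n [m [_ yE]]; apply: ny; exists (- n), (- m).
    by rewrite !rmorphN mulNr -opprD -yE sub0r opprK.
have long_punctured : long_leaf_set `&` punctured_leaf !=set0 -> False.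
  move=> [p [/long_leaf_points pl [x _ px]]]; move: pl; rewrite -px.
  move=> [[t t1 /flat_neq_long]|[x' x'0 /flat_inj]].
    by case.
  have e0 := expR_gt0 x.
  case; [exact: expR_lattice|by apply: axis_not_lattice; rewrite lt_eqF|].
  move=> n [m nm]; have : lattice (expR x - x', 0 - 0 : R) by exists n, m.
  by rewrite subrr => /lattice_horizontal /(_ erefl) []; lra.
have lines y y' : range (flat_line id y) `&` range (flat_line id y') !=set0 ->
    ~ lattice_height y -> ~ lattice_height y' ->
    range (flat_line id y) `<=` range (flat_line id y').
  move=> [_ [[x _ <-] [x' _ /esym /flat_inj]]] + ny ny'.
  move=> /(_ (@height_lattice _ _ ny) (@height_lattice _ _ ny')) lxx'.
  move=> _ [u _ <-]; exists (u - (x - x')) => //; apply: flat_eq.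
  apply: latticeBC; rewrite [X in lattice X](_ : _ = (x, y) - (x', y')) //.
  by congr (_, _) => /=; ring.
case=> [->|->|[y ny ->]] [->|->|[y' ny' ->]] LL => //.
- by rewrite setIC in LL; case: (line_long _ ny' LL).
- by rewrite setIC in LL; case: (long_punctured LL).
- by rewrite setIC in LL; case: (line_punctured _ ny' LL).
- by case: (line_long _ ny LL).
- by case: (line_punctured _ ny LL).
- apply/seteqP; split; first exact: lines.
  by apply: lines => //; rewrite setIC.
Qed.

Lemma is_leafP (L : set (leaf_space F)) : is_leaf L <-> leaf_family L.
Proof.
have comp B x : leaf_family B -> B x ->
    connected_component [set: leaf_space F] x = B.
  apply: component_of_open_cover.
  - exact: leaf_family_open.
  - exact: leaf_family_disjoint.
  - exact: leaf_family_cover.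
split=> [[x ->]|LF].
  by have [B FB Bx] := leaf_family_cover x; rewrite (comp B).
suff [x Lx] : L !=set0 by exists x; rewrite (comp L).
case: LF => [->|->|[y ny ->]].
- by exists (flat (-1, 0)); apply: long_leaf_axis; lra.
- by exists (flat (1, 0)); exact: punctured_leaf_axis.
- by exists (flat (0, y)), 0.
Qed.

(** * Density *)

(** The torus points are dense, and among two points at the same height and close to
    each other at most one is a lattice point. *)
Lemma open_surf_flat (V : set (surf R)) : open V -> V !=set0 ->
  exists2 z, ~ lattice z & \forall w \near z, V (flat w).
Proof.
move=> Vo [p Vp]; suff [z nz Vz] : exists2 z, ~ lattice z & V (flat z).
  by have [+ _] := Vo => /(_ z nz Vz); exists z.
have [[z nz pz]|[t t1 pt]] := surf_cases p; first by exists z; rewrite -?pz.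
rewrite pt in Vp; have [_ /(_ t t1 Vp) [a [b [a0 /andP[at_ tb] [_ VF]]]]] := Vo.
have VF' : \forall y \near (0 : R)^',
    (forall x, curve a y < x < curve b y -> V (flat (x, y))) /\
    curve a y < curve b y.
  by apply: filterI => //; exact: curve_lt a0 (lt_trans at_ tb).
have [y [Vy ab]] := @filter_ex _ _ (Proper_dnbhs_numFieldType (0 : R)) _ VF'.
pose x := curve a y + (curve b y - curve a y) / 3.
pose x' := curve a y + (curve b y - curve a y) / 2.
have [lx|nx] := pselect (lattice (x, y)); last first.
  by exists (x, y) => //; apply: Vy; rewrite /x; lra.
have [lx'|nx'] := pselect (lattice (x', y)); last first.
  by exists (x', y) => //; apply: Vy; rewrite /x'; lra.
have /lattice_horizontal : lattice ((x, y) - (x', y)) by exact: latticeB.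
by rewrite /= subrr => /(_ erefl) []; rewrite /x /x'; lra.
Qed.

Lemma flat_translate (x y : R) g : lattice g ->
  flat (x - g.1, y) = flat (x, y + g.2).
Proof.
move=> lg; apply: flat_eq; rewrite [X in lattice X](_ : _ = - g).
  exact: latticeN.
by case: g {lg} => g1 g2; congr (_, _) => /=; ring.
Qed.

(** The half-leaf [x > 0] is followed to the right, the half-leaf [x < 0] to the
    left, and the others in any direction. *)
Lemma leaf_family_dense (L : set (leaf_space F)) : leaf_family L ->
  @dense (surf R) L.
Proof.
move=> LF V V0 Vo; have [[x y] nz /near_box[e e0 eV]] := open_surf_flat Vo V0.
have hit y' g : lattice g -> `|g.2 - (y - y')| < e -> V (flat (x - g.1, y')).
  move=> lg ge; rewrite flat_translate//; apply: eV.
  by move: ge; rewrite ltr_norml => ge; split => /=; lra.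
case: LF => [->|->|[y' ny ->]].
- have [g [lg ge gx]] := lattice_dense (y - 0) x e0.
  exists (flat (x - g.1, 0)); split; first exact: hit.
  by apply: long_leaf_axis; lra.
- have [g [lg ge gx]] := lattice_dense (- (y - 0)) (- x) e0.
  exists (flat (x - (- g).1, 0)); split.
    apply: hit; first exact: latticeN.
    by move: ge; rewrite !ltr_norml /=; lra.
  by apply: punctured_leaf_axis => /=; lra.
- have [g [lg ge gx]] := lattice_dense (y - y') x e0.
  exists (flat (x - g.1, y')); split; first exact: hit.
  by exists (x - g.1).
Qed.

(** A plaque at height [0] is open in the long leaf, but in the surface every
    neighbourhood of its centre meets the long leaf much further left. *)
Lemma long_leaf_not_embedded : ~ embedded_leaf long_leaf_set.
Proof.
move=> emb.
have nz : ~ lattice (- 2 : R, 0 : R) by apply: axis_not_lattice; rewrite lt_eqF//; lra.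
have [c [r [/andP[r0 r1] tc cdom cmap]]] := torus_chart_ex nz ltr01.
have bz : box (- 2, 0) r (- 2, 0) by exact: box_center.
pose P : set (leaf_space F) := plaque c 0 `&` setT.
have Po : open P by apply: plaque_open; [apply: base_atlas_sub; left|exact: openT].
pose U : set long_leaf_set := set_val @^-1` P.
have Uo : @open long_leaf_set U by exists P.
have /emb [V Vo VU] := Uo.
have Lz : long_leaf_set (flat (- 2, 0)) by apply: long_leaf_axis; lra.
have Vz : V (flat (- 2, 0)).
  pose u : long_leaf_set := exist _ (flat (- 2, 0)) (mem_set Lz).
  have : U u.
    split => //; split; first by rewrite /= cdom; exists (- 2, 0).
    by rewrite /= cmap.
  by rewrite -VU.
have [+ _] := Vo => /(_ _ nz Vz) /near_box[e e0 eV].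
have [g [lg ge g1]] := lattice_dense 0 1 e0.
have Lg : long_leaf_set (flat (- 2 - g.1, 0)) by apply: long_leaf_axis; lra.
have Vg : V (flat (- 2 - g.1, 0)).
  rewrite flat_translate//; apply: eV.
  by move: ge; rewrite ltr_norml => ge; split => /=; lra.
pose u : long_leaf_set := exist _ (flat (- 2 - g.1, 0)) (mem_set Lg).
have [[]] : U u by rewrite -VU.
rewrite cdom => -[w bw wg] + _; rewrite /= -wg cmap// => w2.
have wE : w = (w.1, 0) by rewrite -w2; case: (w).
have [w1 _] := bw; move: w1 wg; rewrite wE /= => w1 /flat_inj [].
- by apply: axis_not_lattice; rewrite lt_eqF//; lra.
- by apply: axis_not_lattice; rewrite lt_eqF//; lra.
- move=> n [m nm]; have : lattice (w.1 - (- 2 - g.1), 0 - 0 : R) by exists n, m.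
  by rewrite subrr => /lattice_horizontal /(_ erefl) []; lra.
Qed.

End all_leaves.

(** * Separation and connectedness *)

Section surface.
Variable R : realType.
Implicit Types (z w q : R * R) (p : surf R) (s t c : closed_long_ray R).

Lemma long_new_inj t t' : t.1 != omega1_0 -> t'.1 != omega1_0 ->
  long t = long t' -> t = t'.
Proof. by move=> t1 t1' /(congr1 val); rewrite !val_long// => -[]. Qed.

(** A neighbourhood of all the new points that shrinks to them with [e]. *)
Definition end_collar (e : R) : set (surf R) :=
  [set p | exists2 t, t.1 != omega1_0 & p = long t] `|`
  flat @` [set z | (- e < z.1 < 0) && (- e < z.2 < e)].

Lemma end_collar_open (e : R) : 0 < e <= 4^-1 -> open (end_collar e).
Proof.
move=> /andP[e0 e4].
have small z : (- e < z.1 < 0) && (- e < z.2 < e) -> ~ lattice z.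
  move=> ze; apply: window_not_lattice.
  by move: ze => /andP[z1 z2]; apply/andP; split; lra.
rewrite surf_openE; split => [z nz [[t t1 /flat_neq_long]|[q qe qz]]|t t1 _].
- by case.
- have [+ _] : surf_open (flat @` [set z | (- e < z.1 < 0) && (- e < z.2 < e)]).
    apply: flat_open => [|w /small//].
    have -> : [set z : R * R | (- e < z.1 < 0) && (- e < z.2 < e)] =
        [set x : R | - e < x < 0] `*` [set y : R | - e < y < e].
      by apply/seteqP; split => w /= => [/andP[]|[-> ->]].
    exact: open_oo2.
  move=> /(_ z nz) H; have : \forall w \near z,
      (flat @` [set z | (- e < z.1 < 0) && (- e < z.2 < e)]) (flat w).
    by apply: H; exists q.
  by apply: filterS => w; right.
- have [|a [a1 a0 aE _]] := @axis_long R (- e / 2); first lra.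
  have [b [tb _]] := long_after t.
  have at_ : (a < t)%O.
    by apply/long_ltP; left; rewrite a1 lt_neqAle eq_sym t1 omega1_0_le.
  have b0 := lt_trans a0 (lt_trans at_ tb).
  exists a, b; split => //; first by rewrite at_.
  split=> [r /andP[ar rb]|].
    have [r1|r1] := eqVneq r.1 omega1_0; last by left; exists r.
    right; exists (1 - (val r.2)^-1, 0); last by rewrite long_flat.
    have r0 := lt_trans a0 ar.
    have a2 := long0_lt a0 a1; have r2 := long0_lt r0 r1.
    have ar2 : val a.2 < val r.2.
      by have /long_ltP[|[]//] := ar; rewrite a1 r1 ltxx.
    have : (val r.2)^-1 < (val a.2)^-1 by rewrite ltf_pV2.
    have := long_axis_neg r1 r0.
    by move=> x0 ra; apply/andP; split => /=; lra.
  near=> y => x /andP[ax xb]; right; exists (x, y) => //.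
  have y0 : y != 0 by near: y; exact: nbhs_dnbhs_neq.
  have ye : `|y| < e by near: y; exact: dnbhs0_lt.
  have := curve_lt0 b0 y0.
  move: ax; rewrite (curve0 _ a1) ?(long0_lt a0 a1)// -aE.
  move: ye; rewrite ltr_norml => ye ax bn; apply/andP; split => /=; lra.
Unshelve. all: by end_near. Qed.

Lemma open_left (m : R) : open [set w : R * R | w.1 < m].
Proof.
rewrite openE => w wm; apply: (@near_fst _ _ w (fun x => x < m)).
exact: lt_nbhsl.
Qed.

Lemma open_right (m : R) : open [set w : R * R | m < w.1].
Proof.
rewrite openE => w wm; apply: (@near_fst _ _ w (fun x => m < x)).
exact: lt_nbhsr.
Qed.

Definition separated_by_opens p p' : Prop :=
  exists A B : set (surf R), [/\ open A, open B, A p, B p' & A `&` B = set0].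

Lemma separated_by_opensC p p' : separated_by_opens p p' -> separated_by_opens p' p.
Proof. by move=> [A [B [Ao Bo Ap Bp AB]]]; exists B, A; rewrite setIC. Qed.

Lemma separate_flat z w : ~ lattice z -> ~ lattice w -> flat z <> flat w ->
  separated_by_opens (flat z) (flat w).
Proof.
move=> nz nw zw; have nzw : ~ lattice (z - w) by move=> /flat_eq.
have [r [/andP[r0 _] rP]] := lattice_box nzw.
have [r1 [/andP[r10 _] r1P]] := lattice_box nz.
have [r2 [/andP[r20 _] r2P]] := lattice_box nw.
exists (flat @` (box z r1 `&` box z (r / 2))), (flat @` (box w r2 `&` box w (r / 2))).
have r20' : 0 < r / 2 by lra.
split.
- apply: flat_open => [|v [/r1P]//]; by apply: openI; exact: box_open.
- apply: flat_open => [|v [/r2P]//]; by apply: openI; exact: box_open.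
- by exists z => //; split; exact: box_center.
- by exists w => //; split; exact: box_center.
- apply/seteqP; split => // _ [[v [v1 v2] <-] [v' [v1' v2'] /flat_inj]].
  move=> /(_ (r2P _ v1') (r1P _ v1)) /latticeBC.
  apply: rP; move: v2 v2' => [/= a1 a2] [/= b1 b2].
  by split => /=; lra.
Qed.

Lemma separate_flat_long z t : ~ lattice z -> t.1 != omega1_0 ->
  separated_by_opens (flat z) (long t).
Proof.
move=> nz t1; have [r [/andP[r0 r4] rP]] := lattice_box nz.
pose e := r / 2; have e0 : 0 < e by rewrite /e; lra.
have e4 : e <= 4^-1 by rewrite /e; lra.
have er : e + e = r by rewrite /e; lra.
have ber v : box z e v -> box z r v.
  by move=> [/= ? ?]; split => /=; lra.
exists (flat @` box z e), (end_collar e); split.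
- by apply: flat_open => [|v /ber/rP//]; exact: box_open.
- by apply: end_collar_open; rewrite e0.
- by exists z => //; exact: box_center.
- by left; exists t.
- apply/seteqP; split => // _ [[v bv <-] [[t' t1' /flat_neq_long]|]]; first by case.
  move=> [q qe /flat_inj]; have nq : ~ lattice q.
    apply: window_not_lattice; move: qe => /andP[q1 q2].
    by apply/andP; split; lra.
  move=> /(_ nq (rP _ (ber _ bv))) /latticeBC; apply: rP.
  move: bv qe => [/= v1 v2] /andP[q1 q2].
  by split => /=; lra.
Qed.

(** Both points are in a common collar, whose coordinate tells them apart. *)
Lemma separate_long t t' : t.1 != omega1_0 -> t'.1 != omega1_0 -> t != t' ->
  separated_by_opens (long t) (long t').
Proof.
wlog tt' : t t' / (t < t')%O.
  move=> wl t1 t1' tt'; have [lt|lt|/eqP] := ltgtP t t'.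
  - exact: wl.
  - by apply: separated_by_opensC; apply: wl => //; rewrite eq_sym.
  - by rewrite (negPf tt').
move=> t1 t1' _; have [h hP] := omega1_enum t'.1.
have tb : (t.1 <= t'.1)%O by have /long_ltP[/ltW|[->]] := tt'.
have ctt' := coord_lt hP tb tt'.
pose m := (coord h t + coord h t') / 2.
exists (collar t'.1 `&` collar_map h @^-1` [set w | w.1 < m]),
  (collar t'.1 `&` collar_map h @^-1` [set w | m < w.1]); split.
- by apply: collar_open => //; exact: open_left.
- by apply: collar_open => //; exact: open_right.
- by split; [left; exists t|rewrite /= collar_map_long//= /m; lra].
- by split; [left; exists t'|rewrite /= collar_map_long//= /m; lra].
- apply/seteqP; split => // p [[_ /= pm] [_ /= mp]].
  by have := lt_trans pm mp; rewrite ltxx.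
Qed.

Lemma surf_hausdorff : hausdorff_space (surf R).
Proof.
rewrite open_hausdorff => p p' /eqP pp'.
suff [A [B [Ao Bo Ap Bp AB]]] : separated_by_opens p p'.
  by exists (A, B); [split; exact/mem_set|split => //; exact/eqP].
have [[z nz pE]|[t t1 pE]] := surf_cases p;
  have [[w nw pE']|[t' t1' pE']] := surf_cases p'; rewrite pE pE' in pp' *.
- exact: separate_flat.
- exact: separate_flat_long.
- by apply: separated_by_opensC; exact: separate_flat_long.
- by apply: separate_long => //; apply/eqP => tt'; apply: pp'; rewrite tt'.
Qed.

(** The closure of a dense leaf. *)
Lemma surf_connected : connected [set: surf R].
Proof.
suff <- : closure (@punctured_leaf R : set (surf R)) = [set: surf R].
  apply: connected_closure; apply: connected_continuous_connected.
    exact: connected_R.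
  apply: continuous_subspaceT; apply: flat_line_continuous_surf.
    exact: continuous_expR.
  exact: expR_lattice.
apply/seteqP; split => // p _ U; rewrite nbhsE => -[V [Vo Vp] VU].
have V0 : V !=set0 by exists p.
have LF : leaf_family (@punctured_leaf R) by constructor 2.
have [q [Vq Lq]] := leaf_family_dense LF V0 Vo.
by exists q; split => //; exact: VU.
Qed.

Lemma surfP : surface R (surf R).
Proof.
split; [exact: surf_connected|exact: surf_hausdorff|move=> p].
have [/(_ p)[c _ cp] _ _] := base_atlas_foliated R.
by exists c.
Qed.

(** * Long spaces are neither separable nor metrizable *)

Lemma omega1_bound (T : countType) (u : T -> omega1) :
  exists b, forall n, (u n < b)%O.
Proof.
apply: contrapT => unbounded; apply: omega1_uncountable.
have -> : [set: omega1] = \bigcup_(n in [set: T]) [set a | (a <= u n)%O].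
  apply/seteqP; split => // b _; apply: contrapT => nb.
  apply: unbounded; exists b => n; rewrite ltNge; apply/negP => bn.
  by apply: nb; exists n.
apply: bigcup_countable => [|n _]; first exact: countableP.
exact: omega1_countable_initial.
Qed.

(** The images of the rationals are bounded, being countably many, hence not
    dense in the image of an unbounded continuous map. *)
Lemma long_ray_not_separable (f : R -> closed_long_ray R) : continuous f ->
  ~ forall t, exists x, (t < f x)%O.
Proof.
move=> fc funb; have [b bP] := omega1_bound (fun q : rat => (f (ratr q)).1).
have [x bx] := funb (mk_long b 0).
have [t' [xt' _]] := long_after (f x).
have /nbhs_ballP[e /= e0 eP] : \forall x' \near x, (mk_long b 0 < f x')%O.
  have itv : (mk_long b 0 < f x < t')%O by rewrite bx.
  have : \forall r \near f x, (mk_long b 0 < r)%O.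
    by apply: filterS (near_long_itv itv) => r /andP[].
  by move=> /fc.
have xe : x < x + e by rewrite ltrDl.
have [q] := rat_in_itvoo xe.
rewrite in_itv /= => /andP[xq qe].
have /eP/long_ltP : ball x e (ratr q) by rewrite /ball /= ltr_norml; lra.
by case=> [|[]] /=; [rewrite ltNge ltW//|move=> bE; have := bP q; rewrite /= -bE ltxx].
Qed.

Lemma real_line_not_long_ray : ~ homeomorphic R (long_ray R).
Proof.
move=> [f [g [fg gf fc gc]]].
apply: (@long_ray_not_separable (set_val \o f)).
  by move=> x; apply: continuous_comp; [exact: fc|exact: initial_continuous].
move=> t; have [t' [tt' _]] := long_after t.
have [r rE] : exists r : long_ray R, set_val r = t'.
  apply: long_ray_ex; apply: le_lt_trans tt'.
  by rewrite leNgt; apply/negP => /long_ltP[|[_]] /=;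
    rewrite ltNge ?omega1_0_le ?ico_ge0.
by exists (g r); rewrite /= gf rE.
Qed.

(** The long line is folded onto the closed long ray. *)
Lemma real_line_not_long_line : ~ homeomorphic R (long_line R).
Proof.
move=> [f [g [fg gf fc gc]]].
pose fold : long_line R -> closed_long_ray R :=
  @wedge_sigT.wedge_fun bool (fun=> closed_long_ray R)
    (fun=> closed_long_ray0 R) _ (fun=> id).
have foldc : continuous fold.
  by apply: wedge_sigT.wedge_fun_continuous => // _ x; exact: cvg_id.
apply: (@long_ray_not_separable (fold \o f)).
  by move=> x; apply: continuous_comp; [exact: fc|exact: foldc].
move=> t; have [t' [tt' _]] := long_after t.
exists (g (@wedge_sigT.wedge_lift bool (fun=> closed_long_ray R)
  (fun=> closed_long_ray0 R) true t')).
by rewrite /= gf /fold wedge_sigT.wedge_lift_funE.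
Qed.

(** Torus points and new points up to stage [b]: these open sets exhaust the surface
    only after omega1 steps. *)
Lemma below_open (b : omega1) :
  open [set p | forall t, t.1 != omega1_0 -> p = long t -> (t.1 <= b)%O].
Proof.
rewrite surf_openE; split => [z nz _|t t1 /(_ t t1 erefl) tb].
  by near=> w => t' t1' /flat_neq_long [].
have [t' [tt' t1']] := long_after t.
have p0 := near_puncture_gt0 R.
exists (near_puncture R), t'; split => //; first by rewrite near_puncture_lt.
split=> [r /andP[pr rt']|]; last first.
  by near=> y => x _ r r1 /flat_neq_long [].
have [r1|r1] := eqVneq r.1 omega1_0.
  by rewrite long_flat// => s s1 /flat_neq_long [].
move=> s s1 /(long_new_inj r1 s1) <-; apply: le_trans tb.
by rewrite -t1'; have /long_ltP[/ltW|[->]] := rt'.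
Unshelve. all: by end_near. Qed.

Lemma surf_flat_rational (V : set (surf R)) : open V -> V !=set0 ->
  exists q : rat * rat, V (flat (ratr q.1, ratr q.2)).
Proof.
move=> Vo V0; have [z _ /near_box[e e0 eV]] := open_surf_flat Vo V0.
have z1e : z.1 < z.1 + e by rewrite ltrDl.
have z2e : z.2 < z.2 + e by rewrite ltrDl.
have [q1] := rat_in_itvoo z1e.
rewrite in_itv /= => q1P.
have [q2] := rat_in_itvoo z2e.
rewrite in_itv /= => q2P.
by exists (q1, q2); apply: eV; split => /=; lra.
Qed.

(** The surface is separable, and in a separable metric space an increasing family
    of open sets, each containing a point outside the earlier ones, is countable:
    if the ball of radius [2 / (k + 1)] around that point is contained in the open
    set, then [k] and an element of the dense set at distance less than
    [1 / (k + 1)] from the point determine the index. *)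
Lemma surf_not_metrizable : ~ metrizable R (surf R).
Proof.
move=> [Y [f [g [fg gf fc gc]]]].
(* At the first ordinal there is no new point, hence the option type in [u]. *)
pose pt (b : omega1) : surf R := long (mk_long b 0).
have pt1 b : b != omega1_0 -> (mk_long (R := R) b 0).1 != omega1_0 by [].
have code b : exists kq : nat * (rat * rat), b != omega1_0 ->
    (forall y : Y, ball (f (pt b)) (kq.1.+1%:R^-1 + kq.1.+1%:R^-1) y ->
      forall t, t.1 != omega1_0 -> g y = long t -> (t.1 <= b)%O) /\
    ball (f (pt b)) kq.1.+1%:R^-1 (f (flat (ratr kq.2.1, ratr kq.2.2))).
  have [b0|b0] := eqVneq b omega1_0; first by exists (0%N, (0, 0)).
  have : \forall y \near f (pt b),
      forall t, t.1 != omega1_0 -> g y = long t -> (t.1 <= b)%O.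
    have below : \forall p \near g (f (pt b)),
        forall t, t.1 != omega1_0 -> p = long t -> (t.1 <= b)%O.
      rewrite fg; apply: open_nbhs_nbhs; split; first exact: below_open.
      by move=> t t1 /(long_new_inj (pt1 _ b0) t1) <- /=.
    exact: (gc _ _ below).
  move=> /nbhs_ballP[e /= e0 eP].
  have e20 : 0 < e / 2 by lra.
  have [k _ /(_ k (leqnn k)) /= ke] := near_infty_natSinv_lt (PosNum e20).
  have {}ke : k.+1%:R^-1 < e / 2 by exact: ke.
  have kk : k.+1%:R^-1 + k.+1%:R^-1 <= e by rewrite [leRHS]splitr lerD// ltW.
  have : nbhs (pt b) (f @^-1` ball (f (pt b)) k.+1%:R^-1).
    by apply: fc; apply: nbhsx_ballx; rewrite invr_gt0.
  rewrite nbhsE => -[V [Vo Vb] VP].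
  have [|q Vq] := surf_flat_rational Vo; first by exists (pt b).
  exists (k, q) => _; split => [y yk|]; last exact: VP.
  exact/eP/(le_ball kk yk).
have /choice[kq kqP] := code.
pose u b := if b == omega1_0 then None else Some (kq b).
have kq_lt b b' : b != omega1_0 -> (b < b')%O -> kq b <> kq b'.
  move=> b0 bb' kqE; have b'0 : b' != omega1_0.
    by apply: contraTneq bb' => ->; rewrite ltNge omega1_0_le.
  have [bnear bq] := kqP b b0; have [_ b'q] := kqP b' b'0.
  rewrite -kqE in b'q.
  have := bnear _ (ball_triangle bq (ball_sym b'q)) _ (pt1 _ b'0) (fg _).
  by rewrite leNgt bb'.
apply: omega1_uncountable; apply/countable_injP.
exists (pickle \o u) => b b' _ _ /= /(pcan_inj pickleK); rewrite /u.
have [->|b0] := eqVneq b omega1_0; first by case: eqVneq => // ->.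
have [//|b'0] := eqVneq b' omega1_0; move=> [kqE].
by have [/(kq_lt _ _ b0)|/(kq_lt _ _ b'0)|//] := ltgtP b b'; rewrite kqE.
Qed.

End surface.

Theorem theorem1p5 (R : realType) :
  exists (M : topologicalType) (F : foliation R M),
    [/\ surface R M, ~ metrizable R M, minimal_foliation F &
        exists L : set (leaf_space F),
          [/\ is_leaf L, long_leaf L,
              (forall L' : set (leaf_space F),
                 is_leaf L' -> long_leaf L' -> L' = L),
              ~ embedded_leaf L &
              forall L' : set (leaf_space F),
                is_leaf L' -> L' <> L -> homeomorphic L' R]].
Proof.
exists (surf R), (surf_foliation R); split.
- exact: surfP.
- exact: surf_not_metrizable.
- by move=> L /is_leafP; exact: leaf_family_dense.
exists (@long_leaf_set R).
have line L : is_leaf L -> L <> @long_leaf_set R -> homeomorphic L R.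
  by move=> /is_leafP; exact: leaf_family_line.
split => //.
- by apply/is_leafP; constructor 1.
- by left; exact: long_curve_homeomorphic.
- move=> L leafL longL; apply: contrapT => /(line L leafL) /homeomorphic_sym RL.
  case: longL => /(homeomorphic_trans RL).
    exact: real_line_not_long_ray.
  exact: real_line_not_long_line.
- exact: long_leaf_not_embedded.
Qed.
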